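(* Let $S$ be a multiplicative subsemigroup of $\mathbb{N}$ containing $1$. Then $\mathscr{H}^\infty_S$ is exactly the multiplier algebra of $\mathscr{H}^2_S$, that is, a function $f:\mathbb{C}_{1/2}\to\mathbb{C}$ satisfies $fg\in\mathscr{H}^2_S$ for all $g\in\mathscr{H}^2_S$ if and only if $f$ has an extension to $\mathbb{C}_0$ which is an element of $\mathscr{H}^\infty_S$. Moreover, in this case (writing $f$ also for the extension), $$\|f\|_\infty=\sup_{g\in\mathscr{H}^2_S,\ \|g\|_2\le 1}\|fg\|_2 .$$
   Context: $\mathbb{N}=\{1,2,3,\dots\}$, $\mathbb{C}_0=\{s\in\mathbb{C}:\operatorname{Re}(s)>0\}$ and $\mathbb{C}_{1/2}=\{s\in\mathbb{C}:\operatorname{Re}(s)>\tfrac12\}$. $\mathscr{H}^\infty$ is the set of all Dirichlet series $f=\sum_{n=1}^\infty a_n n^{-s}$ ($a_n\in\mathbb{C}$ for all $n\in\mathbb{N}$) that converge at each $s\in\mathbb{C}_0$ and satisfy $\|f\|_\infty:=\sup_{s\in\mathbb{C}_0}|f(s)|<\infty$; it is a Banach algebra with pointwise operations and the norm $\|\cdot\|_\infty$. For $S\subset\mathbb{N}$, $\mathscr{H}^\infty_S$ is the set of all $f=\sum_{n=1}^\infty a_n n^{-s}\in\mathscr{H}^\infty$ such that $a_n=0$ for all $n\in\mathbb{N}\setminus S$. $\mathscr{H}^2$ is the Hilbert space of all Dirichlet series $f=\sum_{n=1}^\infty a_n n^{-s}$ with $\|f\|_2:=\left(\sum_{n=1}^\infty|a_n|^2\right)^{1/2}<\infty$;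 each element of $\mathscr{H}^2$ converges on, and is regarded as a holomorphic function on, $\mathbb{C}_{1/2}$. $\mathscr{H}^2_S$ is the closed subspace of all $f=\sum_{n=1}^\infty a_n n^{-s}\in\mathscr{H}^2$ such that $a_n=0$ for all $n\in\mathbb{N}\setminus S$. The product $fg$ is the pointwise product of functions on $\mathbb{C}_{1/2}$. A subset $S$ of $\mathbb{N}$ is a multiplicative subsemigroup of $\mathbb{N}$ if $s_1s_2\in S$ for all $s_1,s_2\in S$. *)

(* Defs.v *)
From Stdlib Require Import Reals.
From Coquelicot Require Import Coquelicot.
Open Scope R_scope.

(* Functions on a half-plane are total functions [C -> C] of which only the
   values on the half-plane are used. The paper's index set is {1, 2, 3, ...}:
   coefficient sequences are [nat -> C] whose value at 0 is never used. *)

Definition half_plane (sigma : R) (s : C) : Prop := sigma < Re s.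

Definition Cexp (z : C) : C :=
  Cmult (RtoC (exp (Re z))) (cos (Im z), sin (Im z)).

(* n^{-s}, for n >= 1 *)
Definition npow (n : nat) (s : C) : C :=
  Cexp (Cmult (Copp s) (RtoC (ln (INR n)))).

Definition is_dirichlet_series (sigma : R) (a : nat -> C) (f : C -> C) : Prop :=
  forall s : C, half_plane sigma s ->
    is_series (V := C_NormedModule)
      (fun k : nat => Cmult (a (S k)) (npow (S k) s)) (f s).

Definition supported_in (A : nat -> Prop) (a : nat -> C) : Prop :=
  forall n : nat, (1 <= n)%nat -> ~ A n -> a n = RtoC 0.

Definition Hinf_norm (f : C -> C) : Rbar :=
  Lub_Rbar (fun r : R => exists s : C, half_plane 0 s /\ r = Cmod (f s)).

Definition Hinf (A : nat -> Prop) (f : C -> C) : Prop :=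
  (exists a : nat -> C, supported_in A a /\ is_dirichlet_series 0 a f) /\
  Rbar_lt (Hinf_norm f) p_infty.

Definition square_summable (a : nat -> C) : Prop :=
  ex_series (fun k : nat => Cmod (a (S k)) ^ 2).

Definition l2_norm (a : nat -> C) : R :=
  sqrt (Series (fun k : nat => Cmod (a (S k)) ^ 2)).

Definition H2 (A : nat -> Prop) (f : C -> C) : Prop :=
  exists a : nat -> C,
    supported_in A a /\ square_summable a /\ is_dirichlet_series (1 / 2) a f.

(* [f] is in H^2 and its norm is [r]; a relation, because the norm is read off
   the coefficients (which are determined by the values of [f]). *)
Definition is_H2_norm (f : C -> C) (r : R) : Prop :=
  exists a : nat -> C,
    square_summable a /\ is_dirichlet_series (1 / 2) a f /\ r = l2_norm a.

Definition pointwise_mul (f g : C -> C) : C -> C := fun s => Cmult (f s) (g s).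

Definition multiplier (A : nat -> Prop) (f : C -> C) : Prop :=
  forall g : C -> C, H2 A g -> H2 A (pointwise_mul f g).

Definition multiplier_norm (A : nat -> Prop) (f : C -> C) : Rbar :=
  Lub_Rbar (fun r : R => exists (g : C -> C) (q : R),
    H2 A g /\ is_H2_norm g q /\ q <= 1 /\ is_H2_norm (pointwise_mul f g) r).

Definition extends (F f : C -> C) : Prop :=
  forall s : C, half_plane (1 / 2) s -> F s = f s.

Definition unital_subsemigroup (A : nat -> Prop) : Prop :=
  (forall n : nat, A n -> (1 <= n)%nat) /\
  A 1%nat /\
  (forall m n : nat, A m -> A n -> A (m * n)%nat).

(* Main.v *)
Require Import Defs.
From Stdlib Require Import Reals Lra Lia ClassicalEpsilon.
From Coquelicot Require Import Coquelicot.
From HB Require Import structures.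
From mathcomp Require Import all_boot zify.
Delimit Scope R_scope with R.
Open Scope R_scope.
Set Implicit Arguments.
Unset Strict Implicit.
Unset Printing Implicit Defensive.

(* Write M_f for multiplication by f; on coefficients it is Dirichlet
   convolution, and it suffices to bound the truncations [nsq N].

   From sup norm to multiplier norm: on a line Re s = sigma > 0 take positive
   means over t of |F g - h|^2 >= 0, with h = sum_(l <= N) c_l l^(-s) and c the
   coefficients of F g. The means extract Dirichlet coefficients although F
   need not be absolutely convergent there: a k-fold average over a window of
   length Y damps all other frequencies by Y^(-k), while F differs from its
   partial sum of length Y^p by O((1 + |t|) Y^(- p sigma / 4)).

   From multiplier norm to sup norm: multiplying the coefficients a_n of a
   multiplier of norm Q by a tent function of log n keeps the norm <= Q, because
   tents are translates of positive definite functions. So the Riesz means of f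
   have multiplier norm <= Q, and telescoping tents of dyadic widths gives
   O(log N) Q for the partial sums. For a Dirichlet polynomial P of multiplier
   norm K, the l2 norm of P^k is at most K^k while its number of terms is
   polynomial in k, so |P| <= K on Re s >= 0. Abel summation now gives
   convergence on Re s > 0, and the Riesz means give the bound Q.

   That a multiplier is bounded is the uniform boundedness principle, proved
   with a gliding hump. *)

(** * Finite sums and limits *)

(** Testing a multiplier on reproducing kernels bounds it only on Re s > 1/2; the strip 0 < Re s <=
    1/2, where even convergence is unknown, is the obstacle. It is reached by working on
    coefficients alone: tents, cut-offs and convolution powers only ever use test sequences
    supported in the semigroup, so multiplier bounds survive them. The logarithmic loss for partial
    sums has only to be beaten by n^(-Re s) and leaves no trace: the sharp constant comes from the
    Riesz means, which is why the two norms agree exactly. Dirichlet convolution is triangular: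
    entry n involves only indices up to n. Bounds on truncations therefore say the same as bounds on
    square summable sequences, and all pairings are finite sums. *)

HB.instance Definition _ :=
  Monoid.isComLaw.Build C (RtoC 0) Cplus Cplus_assoc Cplus_comm Cplus_0_l.
Lemma Rplus_assoc_sym : associative Rplus.
Proof. by move=> x y z; rewrite Rplus_assoc. Qed.
HB.instance Definition _ :=
  Monoid.isComLaw.Build R 0 Rplus Rplus_assoc_sym Rplus_comm Rplus_0_l.

Notation "\csum_ ( i <- r | P ) F" := (\big[Cplus/RtoC 0]_(i <- r | P%B) F%C)
  (at level 41, F at level 41, i, r at level 50).
Notation "\csum_ ( i <- r ) F" := (\big[Cplus/RtoC 0]_(i <- r) F%C)
  (at level 41, F at level 41, i, r at level 50).
Notation "\csum_ ( m <= i < n | P ) F" :=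
  (\big[Cplus/RtoC 0]_(m <= i < n | P%B) F%C)
  (at level 41, F at level 41, i, m, n at level 50).
Notation "\csum_ ( m <= i < n ) F" := (\big[Cplus/RtoC 0]_(m <= i < n) F%C)
  (at level 41, F at level 41, i, m, n at level 50).
Notation "\rsum_ ( i <- r | P ) F" := (\big[Rplus/0]_(i <- r | P%B) F%R)
  (at level 41, F at level 41, i, r at level 50).
Notation "\rsum_ ( m <= i < n | P ) F" :=
  (\big[Rplus/0]_(m <= i < n | P%B) F%R)
  (at level 41, F at level 41, i, m, n at level 50).
Notation "\rsum_ ( m <= i < n ) F" := (\big[Rplus/0]_(m <= i < n) F%R)
  (at level 41, F at level 41, i, m, n at level 50).

Section Sums.
Variables (I : Type) (r : seq I) (P : pred I).
Implicit Types (F G : I -> C) (f g : I -> R).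

Lemma csum_mulr x F :
  (x * (\csum_(i <- r | P i) F i) = \csum_(i <- r | P i) x * F i)%C.
Proof. exact: (big_morph (Cmult x) (Cmult_plus_distr_l x) (Cmult_0_r x)). Qed.

Lemma csum_mull x F :
  ((\csum_(i <- r | P i) F i) * x = \csum_(i <- r | P i) F i * x)%C.
Proof.
by rewrite Cmult_comm csum_mulr; apply: eq_bigr => i _; rewrite Cmult_comm.
Qed.

Lemma rsum_mulr x f :
  x * (\rsum_(i <- r | P i) f i) = \rsum_(i <- r | P i) x * f i.
Proof. exact: (big_morph (Rmult x) (Rmult_plus_distr_l x) (Rmult_0_r x)). Qed.

Lemma rsum_mull x f :
  (\rsum_(i <- r | P i) f i) * x = \rsum_(i <- r | P i) f i * x.
Proof.
by rewrite Rmult_comm rsum_mulr; apply: eq_bigr => i _; rewrite Rmult_comm.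
Qed.

Lemma Cmod_csum F :
  Cmod (\csum_(i <- r | P i) F i) <= \rsum_(i <- r | P i) Cmod (F i).
Proof.
apply: (big_ind2 (fun x y => Cmod x <= y)); first by rewrite Cmod_0; lra.
  by move=> x1 y1 x2 y2 h1 h2; have := Cmod_triangle x1 x2; lra.
by move=> i _; lra.
Qed.

Lemma rsum_le f g : (forall i, P i -> f i <= g i) ->
  \rsum_(i <- r | P i) f i <= \rsum_(i <- r | P i) g i.
Proof.
move=> h; apply: (big_ind2 (fun x y => x <= y)) => //; first by lra.
by move=> x1 y1 x2 y2; lra.
Qed.

Lemma rsum_ge0 f : (forall i, P i -> 0 <= f i) ->
  0 <= \rsum_(i <- r | P i) f i.
Proof. by move=> h; apply: big_ind => //; [lra | move=> x y; lra]. Qed.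

Lemma Re_csum F : Re (\csum_(i <- r | P i) F i) = \rsum_(i <- r | P i) Re (F i).
Proof. by apply: (big_morph Re). Qed.

Lemma RtoC_rsum f :
  RtoC (\rsum_(i <- r | P i) f i) = \csum_(i <- r | P i) RtoC (f i).
Proof. by apply: (big_morph RtoC) => // x y; rewrite RtoC_plus. Qed.

Lemma Cconj_csum F :
  Cconj (\csum_(i <- r | P i) F i) = \csum_(i <- r | P i) Cconj (F i).
Proof.
apply: (big_morph Cconj); first by move=> x y; rewrite Cplus_conj.
by rewrite /Cconj /=; congr pair; lra.
Qed.

Lemma csum_plus F G : (\csum_(i <- r | P i) (F i + G i) =
  (\csum_(i <- r | P i) F i) + \csum_(i <- r | P i) G i)%C.
Proof. exact: big_split. Qed.

Lemma rsum_plus f g : \rsum_(i <- r | P i) (f i + g i) =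
  \rsum_(i <- r | P i) f i + \rsum_(i <- r | P i) g i.
Proof. exact: big_split. Qed.

End Sums.

Lemma rsum_nat_le (m n : nat) (f g : nat -> R) :
  (forall i, (m <= i < n)%N -> f i <= g i) ->
  \rsum_(m <= i < n) f i <= \rsum_(m <= i < n) g i.
Proof. by move=> h; rewrite !big_nat; apply: rsum_le. Qed.

Lemma rsum_nat_ge0 (m n : nat) (f : nat -> R) :
  (forall i, (m <= i < n)%N -> 0 <= f i) -> 0 <= \rsum_(m <= i < n) f i.
Proof. by move=> h; rewrite big_nat; apply: rsum_ge0. Qed.

Lemma rsum_nat_const (m n : nat) (c : R) :
  \rsum_(m <= i < n) c = INR (n - m) * c.
Proof.
rewrite big_const_nat; elim: (n - m)%N => [|k IH]; first by rewrite /=; lra.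
by rewrite iterS IH S_INR; lra.
Qed.

Lemma rsum_widen (n m : nat) (f : nat -> R) : (n <= m)%N ->
  (forall i, (1 <= i)%N -> 0 <= f i) ->
  \rsum_(1 <= i < n.+1) f i <= \rsum_(1 <= i < m.+1) f i.
Proof.
move=> nm f0; rewrite (@big_cat_nat _ _ _ n.+1 1 m.+1) //=.
have : 0 <= \rsum_(n.+1 <= i < m.+1) f i.
  by apply: rsum_nat_ge0 => i /andP[h _]; apply: f0; apply: leq_trans h.
by lra.
Qed.

Lemma rsum_recr (n : nat) (f : nat -> R) :
  \rsum_(1 <= i < n.+2) f i = (\rsum_(1 <= i < n.+1) f i) + f n.+1.
Proof. exact: big_nat_recr. Qed.

Lemma csum_recr (n : nat) (f : nat -> C) :
  (\csum_(1 <= i < n.+2) f i = (\csum_(1 <= i < n.+1) f i) + f n.+1)%C.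
Proof. exact: big_nat_recr. Qed.

Definition Clim (u : nat -> C) (l : C) : Prop :=
  forall eps, 0 < eps -> exists N, forall n, (N <= n)%N -> Cmod (u n - l) < eps.

Lemma Clim_const (l : C) : Clim (fun=> l) l.
Proof.
move=> e e0; exists 0%N => n _; have -> : (l - l)%C = 0 by ring.
by rewrite Cmod_0.
Qed.

Lemma Clim_ext (u v : nat -> C) (l : C) :
  (forall n, u n = v n) -> Clim u l -> Clim v l.
Proof. by move=> h L e /L[N HN]; exists N => n; rewrite -h; apply: HN. Qed.

Lemma Clim_plus (u v : nat -> C) (l m : C) :
  Clim u l -> Clim v m -> Clim (fun n => u n + v n)%C (l + m).
Proof.
move=> Lu Lv e e0; have [|N HN] := Lu (e / 2); first lra.
have [|M HM] := Lv (e / 2); first lra.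
exists (maxn N M) => n; rewrite geq_max => /andP[/HN h1 /HM h2].
have -> : (u n + v n - (l + m) = (u n - l) + (v n - m))%C by ring.
by have := Cmod_triangle (u n - l) (v n - m); lra.
Qed.

Lemma Clim_scal (x : C) (u : nat -> C) (l : C) :
  Clim u l -> Clim (fun n => x * u n)%C (x * l).
Proof.
move=> Lu e e0; have hx := Cmod_ge_0 x.
have [|N HN] := Lu (e / (Cmod x + 1)); first by apply: Rdiv_lt_0_compat; lra.
exists N => n /HN h; have -> : (x * u n - x * l = x * (u n - l))%C by ring.
rewrite Cmod_mult; have h0 := Cmod_ge_0 (u n - l).
have : Cmod (u n - l) * (Cmod x + 1) < e.
  have := Rmult_lt_compat_r (Cmod x + 1) _ _ ltac:(lra) h.
  by rewrite /Rdiv Rmult_assoc Rinv_l; lra.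
by nra.
Qed.

Lemma Clim_sum (I : Type) (r : seq I) (P : pred I) (u : I -> nat -> C)
  (l : I -> C) : (forall i, P i -> Clim (u i) (l i)) ->
  Clim (fun n => \csum_(i <- r | P i) u i n) (\csum_(i <- r | P i) l i).
Proof.
move=> h; elim: r => [|i r IH].
  by apply: (@Clim_ext (fun=> RtoC 0)) => [n|]; rewrite big_nil //; apply: Clim_const.
rewrite big_cons; case Pi: (P i).
  apply: Clim_ext (Clim_plus (h i Pi) IH) => n.
  by rewrite big_cons Pi.
by apply: Clim_ext IH => n; rewrite big_cons Pi.
Qed.

Lemma Clim_unique (u : nat -> C) (l m : C) : Clim u l -> Clim u m -> l = m.
Proof.
move=> Lu Lm; apply: NNPP => lm.
have d0 : 0 < Cmod (l - m).
  by apply/Cmod_gt_0 => h; apply: lm; rewrite -(Cplus_0_r m) -h; ring.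
have [|N HN] := Lu (Cmod (l - m) / 2); first lra.
have [|M HM] := Lm (Cmod (l - m) / 2); first lra.
have h1 := HN _ (leq_maxl N M); have h2 := HM _ (leq_maxr N M).
set x := u _ in h1 h2.
have := Cmod_triangle (- (x - l)) (x - m); rewrite Cmod_opp.
have -> : (- (x - l) + (x - m) = l - m)%C by ring.
lra.
Qed.

Lemma Clim_Cmod_le (u : nat -> C) (l : C) (M : R) (N0 : nat) : Clim u l ->
  (forall n, (N0 <= n)%N -> Cmod (u n) <= M) -> Cmod l <= M.
Proof.
move=> Lu h; apply: le_epsilon => e e0; have [N HN] := Lu e e0.
have h1 := HN _ (leq_maxl N N0); have h2 := h _ (leq_maxr N N0).
set x := u _ in h1 h2; have := Cmod_triangle x (- (x - l)).
rewrite Cmod_opp; have -> : (x + - (x - l) = l)%C by ring.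
lra.
Qed.

Lemma Re_Clim_ge0 (u : nat -> C) (l : C) : Clim u l ->
  (forall n, 0 <= Re (u n)) -> 0 <= Re l.
Proof.
move=> Lu h; apply: le_epsilon => e e0; have [N HN] := Lu e e0.
have h1 := HN N (leqnn N); have h2 := h N.
have := Rle_trans _ _ _ (Rmax_l _ _) (Rmax_Cmod (u N - l)%C).
have -> : fst (u N - l)%C = Re (u N) - Re l by rewrite /Re /=; lra.
by move/Rabs_le_between; lra.
Qed.

Lemma sum_n_csum (a : nat -> C) (n : nat) :
  sum_n (G := C_AbelianMonoid) (fun k => a k.+1) n = \csum_(1 <= i < n.+2) a i.
Proof.
elim: n => [|n IH]; first by rewrite sum_O big_nat1.
by rewrite sum_Sn IH [RHS]big_nat_recr.
Qed.

Lemma sum_n_rsum (a : nat -> R) (n : nat) :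
  sum_n (fun k => a k.+1) n = \rsum_(1 <= i < n.+2) a i.
Proof.
elim: n => [|n IH]; first by rewrite sum_O big_nat1.
by rewrite sum_Sn IH [RHS]big_nat_recr.
Qed.

Lemma is_series_Clim (a : nat -> C) (l : C) :
  is_series (V := C_NormedModule) (fun k => a k.+1) l <->
  Clim (fun N => \csum_(1 <= i < N.+1) a i) l.
Proof.
rewrite /is_series; split.
  move/filterlim_locally_ball_norm => h e e0.
  have [N HN] := h (mkposreal e e0); exists N.+1 => -[//|n] hn.
  have := HN n ltac:(lia); rewrite /ball_norm /= sum_n_csum.
  exact.
move=> h; apply/filterlim_locally_ball_norm => e.
have [N HN] := h e (cond_pos e); exists N => n hn.
rewrite /ball_norm sum_n_csum; apply: HN; lia.
Qed.

Lemma is_dirichlet_seriesE (sigma : R) (a : nat -> C) (f : C -> C) :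
  is_dirichlet_series sigma a f <-> forall s, half_plane sigma s ->
    Clim (fun N => \csum_(1 <= n < N.+1) a n * npow n s)%C (f s).
Proof.
split=> h s hs.
  by apply/is_series_Clim; apply: h.
by apply/(is_series_Clim (fun n => a n * npow n s)%C); apply: h.
Qed.

Definition nsq (N : nat) (b : nat -> C) : R :=
  \rsum_(1 <= n < N.+1) Cmod (b n) ^ 2.

Lemma nsq_ge0 N b : 0 <= nsq N b.
Proof. by apply: rsum_nat_ge0 => i _; apply: pow2_ge_0. Qed.

Lemma nsq_widen (n m : nat) b : (n <= m)%N -> nsq n b <= nsq m b.
Proof. by move=> h; apply: rsum_widen => // i _; apply: pow2_ge_0. Qed.

Lemma nsq_ext (N : nat) b c :
  (forall n, (1 <= n <= N)%N -> b n = c n) -> nsq N b = nsq N c.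
Proof. by move=> h; apply: eq_big_nat => n hn; rewrite h. Qed.

Lemma square_summableP (a : nat -> C) :
  square_summable a <-> exists B, forall N, nsq N a <= B.
Proof.
split=> [[l hl]|[B HB]].
  exists l => N; apply: Rle_trans (nsq_widen a (leqnSn N)) _.
  rewrite /nsq -(sum_n_rsum (fun n => Cmod (a n) ^ 2)).
  apply: (is_lim_seq_incr_compare _ l hl) => n.
  rewrite sum_Sn /plus /=; have := pow2_ge_0 (Cmod (a n.+2)); rewrite /=; lra.
apply: (ex_finite_lim_seq_incr _ B) => n.
  rewrite sum_Sn /plus /=; have := pow2_ge_0 (Cmod (a n.+2)); rewrite /=; lra.
by rewrite (sum_n_rsum (fun n => Cmod (a n) ^ 2)); apply: HB.
Qed.

Lemma nsq_le_l2_norm (a : nat -> C) (N : nat) :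
  square_summable a -> nsq N a <= l2_norm a ^ 2.
Proof.
move=> sa.
have h M : nsq M a <= Series (fun k => Cmod (a (S k)) ^ 2).
  apply: Rle_trans (nsq_widen a (leqnSn M)) _.
  rewrite /nsq -(sum_n_rsum (fun n => Cmod (a n) ^ 2)).
  apply: (is_lim_seq_incr_compare _ _ (Series_correct _ sa)) => n.
  rewrite sum_Sn /plus /=; have := pow2_ge_0 (Cmod (a n.+2)); rewrite /=; lra.
rewrite /l2_norm pow2_sqrt //.
exact: Rle_trans (nsq_ge0 0 a) (h 0%N).
Qed.

Lemma l2_norm_le (a : nat -> C) (B : R) :
  (forall N, nsq N a <= B) -> l2_norm a <= sqrt B.
Proof.
move=> HB; have sa : square_summable a by apply/square_summableP; exists B.
apply: sqrt_le_1_alt.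
have : is_lim_seq (sum_n (fun k => Cmod (a k.+1) ^ 2))
  (Series (fun k => Cmod (a k.+1) ^ 2)) := Series_correct _ sa.
move=> L.
have hle n : sum_n (fun k => Cmod (a k.+1) ^ 2) n <= B.
  by rewrite (sum_n_rsum (fun n => Cmod (a n) ^ 2)); apply: HB.
exact: (is_lim_seq_le _ _ _ _ hle L (is_lim_seq_const B)).
Qed.

(** * Powers and Dirichlet convolution *)

Lemma Cexp_plus (z w : C) : Cexp (z + w) = (Cexp z * Cexp w)%C.
Proof.
rewrite /Cexp /= exp_plus cos_plus sin_plus.
by rewrite /RtoC /Cmult /Re /Im /=; congr pair; ring.
Qed.

Lemma Cexp_0 : Cexp 0 = 1.
Proof. by rewrite /Cexp /= exp_0 cos_0 sin_0 Cmult_1_l. Qed.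

Lemma Cmod_Cexp (z : C) : Cmod (Cexp z) = exp (Re z).
Proof.
rewrite /Cexp Cmod_mult Cmod_R Rabs_pos_eq; last exact: Rlt_le (exp_pos _).
rewrite /Cmod /=; have -> : cos (Im z) * (cos (Im z) * 1) +
  sin (Im z) * (sin (Im z) * 1) = 1.
  by have := sin2_cos2 (Im z); rewrite /Rsqr; lra.
by rewrite sqrt_1; lra.
Qed.

Lemma exp_le_compat (x y : R) : x <= y -> exp x <= exp y.
Proof. by case=> [/exp_increasing|->]; lra. Qed.

Lemma INR_pos (n : nat) : (1 <= n)%N -> 0 < INR n.
Proof. by move=> h; apply: lt_0_INR; lia. Qed.

Lemma INR_ge1 (n : nat) : (1 <= n)%N -> 1 <= INR n.
Proof. by move=> h; have := le_INR 1 n; rewrite /=; apply; lia. Qed.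

Lemma ln_ge0 (n : nat) : (1 <= n)%N -> 0 <= ln (INR n).
Proof. by move=> h; rewrite -ln_1; apply: ln_le; [lra | apply: INR_ge1]. Qed.

Lemma ln_mult_nat (i j : nat) : (1 <= i)%N -> (1 <= j)%N ->
  ln (INR (i * j)) = ln (INR i) + ln (INR j).
Proof. by move=> hi hj; rewrite mult_INR ln_mult //; apply: INR_pos. Qed.

Definition rpow (n : nat) (x : R) : R := exp (- x * ln (INR n)).

Lemma rpow_pos n x : 0 < rpow n x.
Proof. exact: exp_pos. Qed.

Lemma rpow_plus n x y : rpow n (x + y) = rpow n x * rpow n y.
Proof. by rewrite /rpow -exp_plus; congr exp; ring. Qed.

Lemma rpow1n x : rpow 1 x = 1.
Proof. by rewrite /rpow /= ln_1 Rmult_0_r exp_0. Qed.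

Lemma rpown0 n : rpow n 0 = 1.
Proof. by rewrite /rpow Ropp_0 Rmult_0_l exp_0. Qed.

Lemma rpow_decr (n m : nat) x : (1 <= n)%N -> (n <= m)%N -> 0 <= x ->
  rpow m x <= rpow n x.
Proof.
move=> n1 nm x0; apply: exp_le_compat.
have : ln (INR n) <= ln (INR m).
  by apply: ln_le; [apply: INR_pos | apply: le_INR; lia].
by nra.
Qed.

Lemma rpow_le1 (n : nat) x : (1 <= n)%N -> 0 <= x -> rpow n x <= 1.
Proof. by move=> n1 x0; rewrite -(rpow1n x); apply: rpow_decr. Qed.

Lemma rpow_INR (n k : nat) : (1 <= n)%N -> rpow n (INR k) = (/ INR n) ^ k.
Proof.
move=> n1; elim: k => [|k IH]; first by rewrite rpown0.
rewrite S_INR rpow_plus IH /= Rmult_comm; congr (_ * _).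
by rewrite /rpow -Ropp_mult_distr_l Rmult_1_l exp_Ropp exp_ln //; apply: INR_pos.
Qed.

Lemma rpow1 (n : nat) : (1 <= n)%N -> rpow n 1 = / INR n.
Proof. by move=> n1; rewrite (rpow_INR 1 n1) /= Rmult_1_r. Qed.

Lemma ln_S_sub (n : nat) : (1 <= n)%N ->
  / INR n.+1 <= ln (INR n.+1) - ln (INR n).
Proof.
move=> n1; have p := INR_pos n1; have p' : 0 < INR n.+1 by apply: INR_pos.
have := exp_ineq1_le (ln (INR n / INR n.+1)).
rewrite exp_ln; last exact: Rdiv_lt_0_compat.
rewrite ln_div // => h.
have : INR n / INR n.+1 = 1 - / INR n.+1 by rewrite S_INR in p' *; field; lra.
by lra.
Qed.

Lemma rpow_sub (n : nat) x : (1 <= n)%N ->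
  x * (ln (INR n.+1) - ln (INR n)) * rpow n.+1 x <= rpow n x - rpow n.+1 x.
Proof.
move=> n1; set d := ln _ - ln _.
have -> : rpow n x = exp (x * d) * rpow n.+1 x.
  by rewrite /rpow -exp_plus /d; congr exp; ring.
have := exp_ineq1_le (x * d); have := rpow_pos n.+1 x; nra.
Qed.

(** Discrete form of the comparison with an integral: by [ln_S_sub] and [rpow_sub] each term from
    the second on is at most a difference of consecutive values of [rpow n x / x], and these
    telescope. *)
Lemma rsum_rpow (x : R) (N : nat) : 0 < x ->
  \rsum_(1 <= n < N.+1) rpow n (1 + x) <= 1 + / x.
Proof.
move=> x0; have ix : 0 < / x by apply: Rinv_0_lt_compat.
suff h : \rsum_(1 <= n < N.+2) rpow n (1 + x) <= 1 + (1 - rpow N.+1 x) / x.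
  have := Rmult_lt_0_compat _ _ (rpow_pos N.+1 x) ix.
  have := rpow_pos N.+1 (1 + x); move: h; rewrite rsum_recr /Rdiv; lra.
elim: N => [|N IH].
  by rewrite big_nat1 !rpow1n; lra.
rewrite rsum_recr; have h1 := ln_S_sub (ltn0Sn N).
have h2 := rpow_sub x (ltn0Sn N); have p := rpow_pos N.+2 x.
rewrite [in X in _ + X <= _]rpow_plus rpow1 //.
have h3 : x * (/ INR N.+2 * rpow N.+2 x) <= rpow N.+1 x - rpow N.+2 x.
  apply: Rle_trans h2; rewrite Rmult_assoc.
  by apply: Rmult_le_compat_l; [lra | apply: Rmult_le_compat_r; lra].
have h4 := Rmult_le_compat_r (/ x) _ _ (Rlt_le _ _ ix) h3.
have : x * (/ INR N.+2 * rpow N.+2 x) * / x = / INR N.+2 * rpow N.+2 x.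
  by field; have := INR_pos (ltn0Sn N.+1); lra.
move: IH; rewrite /Rdiv; lra.
Qed.

Lemma Cmod_npow n s : Cmod (npow n s) = rpow n (Re s).
Proof. by rewrite /npow Cmod_Cexp /rpow /Re /=; congr exp; ring. Qed.

Lemma npow_mult (i j : nat) s : (1 <= i)%N -> (1 <= j)%N ->
  npow (i * j) s = (npow i s * npow j s)%C.
Proof.
move=> hi hj; rewrite /npow -Cexp_plus ln_mult_nat // RtoC_plus.
by congr Cexp; ring.
Qed.

Lemma npow_plus n s z : npow n (s + z) = (npow n s * npow n z)%C.
Proof. by rewrite /npow -Cexp_plus; congr Cexp; ring. Qed.

Lemma npow1n s : npow 1 s = 1.
Proof. by rewrite /npow /= ln_1 Cmult_0_r Cexp_0. Qed.

(** Dirichlet convolution, summed over pairs rather than divisors so that the two sums can be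
    exchanged and their ranges enlarged. *)
Definition conv (a b : nat -> C) (n : nat) : C :=
  \csum_(1 <= i < n.+1) \csum_(1 <= j < n.+1 | (i * j == n)%N) a i * b j.

Lemma csum_shrink (n K : nat) (f : nat -> C) : (n <= K)%N ->
  (forall i, (n < i)%N -> f i = 0) ->
  \csum_(1 <= i < K.+1) f i = \csum_(1 <= i < n.+1) f i.
Proof.
move=> nK h; rewrite (@big_cat_nat _ _ _ n.+1 1 K.+1) //=.
have -> : (\csum_(n.+1 <= i < K.+1) f i = 0)%C; last exact: Cplus_0_r.
by rewrite big_nat big1 // => i /andP[hi _]; apply: h.
Qed.

Lemma conv_widen (K n : nat) a b : (n <= K)%N -> conv a b n =
  \csum_(1 <= i < K.+1) \csum_(1 <= j < K.+1 | (i * j == n)%N) a i * b j.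
Proof.
move=> nK; rewrite /conv; case: n nK => [|n] nK.
  rewrite big_geq // big_nat big1 // => i hi; rewrite big_nat_cond big1 // => j.
  by move/andP=> [hj /eqP]; lia.
symmetry; rewrite (@csum_shrink n.+1) //; last first.
  move=> i hi; rewrite big_nat_cond big1 // => j /andP[hj /eqP]; nia.
apply: eq_big_nat => i hi; rewrite big_mkcond [RHS]big_mkcond /=.
by apply: csum_shrink => // j hj; case: eqP => //; nia.
Qed.

Lemma csum_pick (N m : nat) (f : nat -> C) : (1 <= m)%N ->
  (\csum_(1 <= n < N.+1) (if m == n then f n else 0) =
  if (m <= N)%N then f m else 0)%C.
Proof.
move=> m1; elim: N => [|N IH]; first by rewrite big_geq //; case: ifP => //; lia.
rewrite csum_recr IH; case: (ltngtP m N.+1) => h.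
- by rewrite -ltnS h Cplus_0_r.
- by case: ifP; [lia | rewrite Cplus_0_l].
- by rewrite h ltnn Cplus_0_l.
Qed.

(** Displays the pairing with [d] as a matrix whose entry at input [j] and output [i * j] is [a i];
    Schur multipliers act on these entries. *)
Lemma sum_conv (N : nat) a b d :
  (\csum_(1 <= n < N.+1) conv a b n * d n = \csum_(1 <= i < N.+1)
    \csum_(1 <= j < N.+1 | (i * j <= N)%N) a i * b j * d (i * j)%N)%C.
Proof.
transitivity (\csum_(1 <= n < N.+1) \csum_(1 <= i < N.+1)
  \csum_(1 <= j < N.+1) (if (i * j == n)%N then a i * b j * d n else 0)).
  apply: eq_big_nat => n hn; rewrite (@conv_widen N) ?csum_mull; last lia.
  apply: eq_bigr => i _; rewrite csum_mull big_mkcond.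
  by apply: eq_bigr => j _; case: ifP.
rewrite exchange_big; apply: eq_big_nat => i hi; rewrite exchange_big.
rewrite [RHS]big_mkcond; apply: eq_big_nat => j hj.
by rewrite /= (csum_pick N (fun n => a i * b j * d n)%C); [case: ifP | lia].
Qed.

Lemma conv_npow a b n s : conv (fun n => a n * npow n s)%C
  (fun n => b n * npow n s)%C n = (conv a b n * npow n s)%C.
Proof.
rewrite /conv csum_mull; apply: eq_big_nat => i hi; rewrite csum_mull.
rewrite big_nat_cond [RHS]big_nat_cond; apply: eq_bigr => j.
move=> /andP[hj /eqP hn]; rewrite -[in RHS]hn npow_mult; [ring | lia | lia].
Qed.

Lemma conv_ext (N : nat) a b c :
  (forall n, (1 <= n <= N)%N -> b n = c n) -> conv a b N = conv a c N.
Proof.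
move=> h; apply: eq_bigr => i _; rewrite big_nat_cond [RHS]big_nat_cond.
by apply: eq_bigr => j /andP[hj _]; rewrite h //; lia.
Qed.

Lemma conv_plus a b c n :
  conv a (fun n => b n + c n)%C n = (conv a b n + conv a c n)%C.
Proof.
rewrite /conv -csum_plus; apply: eq_bigr => i _; rewrite -csum_plus.
by apply: eq_bigr => j _; ring.
Qed.

Lemma conv_scal a x b n : conv a (fun n => x * b n)%C n = (x * conv a b n)%C.
Proof.
rewrite /conv csum_mulr; apply: eq_bigr => i _; rewrite csum_mulr.
by apply: eq_bigr => j _; ring.
Qed.

Lemma supported_conv (A : nat -> Prop) a b : unital_subsemigroup A ->
  supported_in A a -> supported_in A b -> supported_in A (conv a b).
Proof.
move=> [_ [_ hA]] sa sb n n1 nA; rewrite /conv big_nat big1 // => i hi.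
rewrite big_nat_cond big1 // => j /andP[hj /eqP hn].
case: (classic (A i)) => Ai; last by rewrite (sa i) ?Cmult_0_l //; lia.
rewrite (sb j) ?Cmult_0_r //; first lia.
by move=> Aj; apply: nA; rewrite -hn; apply: hA.
Qed.

Definition unit_coef (n : nat) : C := if n == 1%N then 1 else 0.

Lemma supported_unit (A : nat -> Prop) :
  unital_subsemigroup A -> supported_in A unit_coef.
Proof.
by move=> [_ [A1 _]] n _ nA; rewrite /unit_coef; case: eqP => // h; rewrite h in nA.
Qed.

Lemma nsq_unit (N : nat) : nsq N unit_coef <= 1.
Proof.
case: N => [|N]; first by rewrite /nsq big_geq //; lra.
rewrite /nsq big_ltn // big_nat big1 => [|i hi].
  by rewrite /unit_coef /= Cmod_1; lra.
by rewrite /unit_coef; case: eqP => [|_]; [lia | rewrite Cmod_0 /=; ring].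
Qed.

Lemma conv_unit a n : (1 <= n)%N -> conv a unit_coef n = a n.
Proof.
move=> n1; rewrite /conv; transitivity (\csum_(1 <= i < n.+1)
    (if n == i then a i else 0)); last by rewrite csum_pick // leqnn.
apply: eq_big_nat => i hi.
transitivity (\csum_(1 <= j < n.+1)
    (if 1%N == j then (if n == i then a i else 0) else 0))%C; last first.
  by rewrite (csum_pick n (fun _ => if n == i then a i else 0)%C) // n1.
rewrite big_mkcond; apply: eq_big_nat => j hj; rewrite /unit_coef.
case: (eqVneq j 1%N) => [->|j1].
  by rewrite muln1 eq_sym /=; case: ifP => // _; ring.
by case: ifP => // _; ring.
Qed.

(** * Products and uniqueness of Dirichlet series *)

Lemma Clim_Re_Im (u : nat -> C) (x y : R) :
  is_lim_seq (fun n => Re (u n)) x -> is_lim_seq (fun n => Im (u n)) y ->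
  Clim u (x, y).
Proof.
move=> /is_lim_seq_spec hx /is_lim_seq_spec hy e e0.
have e2 : 0 < e / 2 by lra.
have [N HN] := hx (mkposreal _ e2); have [M HM] := hy (mkposreal _ e2).
exists (maxn N M) => n; rewrite geq_max => /andP[h1 h2].
have {}h1 : Rabs (Re (u n) - x) < e / 2 by apply: HN; lia.
have {}h2 : Rabs (Im (u n) - y) < e / 2 by apply: HM; lia.
have -> : (u n - (x, y))%C = (RtoC (Re (u n) - x) + Ci * RtoC (Im (u n) - y))%C.
  by rewrite /Re /Im /Cminus /Cplus /Cmult /Copp /RtoC /Ci /=; congr pair; ring.
apply: Rle_lt_trans (Cmod_triangle _ _) _; rewrite Cmod_mult !Cmod_R.
have -> : Cmod Ci = 1; last by lra.
by rewrite /Cmod /Ci /=; rewrite -[RHS]sqrt_1; congr sqrt; ring.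
Qed.

Lemma Re_le_Cmod (z : C) : Rabs (Re z) <= Cmod z.
Proof. exact: Rle_trans (Rmax_l _ _) (Rmax_Cmod z). Qed.

Lemma Im_le_Cmod (z : C) : Rabs (Im z) <= Cmod z.
Proof. exact: Rle_trans (Rmax_r _ _) (Rmax_Cmod z). Qed.

Lemma Clim_cauchy (u : nat -> C) :
  (forall eps, 0 < eps -> exists N, forall n m, (N <= n <= m)%N ->
     Cmod (u m - u n) < eps) -> exists l, Clim u l.
Proof.
move=> h.
have c (p : C -> R) : (forall z, Rabs (p z) <= Cmod z) ->
    (forall z w, p (z - w)%C = p z - p w) ->
    exists l : R, is_lim_seq (fun n => p (u n)) l.
  move=> hp hp'; apply/ex_lim_seq_cauchy_corr => e.
  have [N HN] := h e (cond_pos e); exists N => n m hn hm.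
  case: (leqP n m) => nm.
    rewrite Rabs_minus_sym -hp'; apply: Rle_lt_trans (hp _) _; apply: HN; lia.
  rewrite -hp'; apply: Rle_lt_trans (hp _) _; apply: HN; lia.
have [x hx] : exists l : R, is_lim_seq (fun n => Re (u n)) l.
  by apply: c; [apply: Re_le_Cmod | move=> z w; rewrite /Re /=; ring].
have [y hy] : exists l : R, is_lim_seq (fun n => Im (u n)) l.
  by apply: c; [apply: Im_le_Cmod | move=> z w; rewrite /Im /=; ring].
by exists (x, y); apply: Clim_Re_Im.
Qed.

Lemma bounded_incr_cauchy (P : nat -> R) (B : R) :
  (forall n m, (n <= m)%N -> P n <= P m) -> (forall n, P n <= B) ->
  forall eps, 0 < eps -> exists N, forall n m, (N <= n <= m)%N ->
    P m - P n < eps.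
Proof.
move=> incr bd e e0.
have /ex_finite_lim_seq_correct [_] : ex_finite_lim_seq P.
  by apply: (ex_finite_lim_seq_incr _ B) => // n; apply: incr.
have /ex_lim_seq_cauchy_corr h : ex_finite_lim_seq P.
  by apply: (ex_finite_lim_seq_incr _ B) => // n; apply: incr.
move=> _; have [N HN] := h (mkposreal e e0); exists N => n m /andP[h1 h2].
by have /Rabs_def2 := HN m n ltac:(lia) ltac:(lia); rewrite /=; lra.
Qed.

Lemma abs_summable_Clim (u : nat -> C) (B : R) :
  (forall N, \rsum_(1 <= n < N.+1) Cmod (u n) <= B) ->
  exists l, Clim (fun N => \csum_(1 <= n < N.+1) u n) l.
Proof.
move=> hB; apply: Clim_cauchy => e e0.
have incr n m : (n <= m)%N -> \rsum_(1 <= i < n.+1) Cmod (u i) <=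
    \rsum_(1 <= i < m.+1) Cmod (u i).
  by move=> nm; apply: rsum_widen => // i _; apply: Cmod_ge_0.
have [N HN] := bounded_incr_cauchy incr hB e0; exists N => n m hnm.
apply: Rle_lt_trans (HN n m hnm).
rewrite !(@big_cat_nat _ _ _ n.+1 1 m.+1) /=; try lia.
set x := (\csum_(1 <= i < _) _)%C; set y := (\csum_(_ <= i < _) _)%C.
have -> : (x + y - x = y)%C by ring.
by have := Cmod_csum (index_iota n.+1 m.+1) xpredT u; rewrite -/y; lra.
Qed.

Lemma Clim_mult (u v : nat -> C) (U V : C) (B : R) :
  Clim u U -> Clim v V -> (forall n, Cmod (v n) <= B) ->
  Clim (fun n => u n * v n)%C (U * V).
Proof.
move=> hu hv hB e e0.
have B0 : 0 <= B := Rle_trans _ _ _ (Cmod_ge_0 (v 0%N)) (hB 0%N).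
have U0 := Cmod_ge_0 U.
have [|N HN] := hu (e / 2 / (B + 1)).
  by apply: Rdiv_lt_0_compat; lra.
have [|M HM] := hv (e / 2 / (Cmod U + 1)).
  by apply: Rdiv_lt_0_compat; lra.
exists (maxn N M) => n; rewrite geq_max => /andP[/HN h1 /HM h2].
have -> : (u n * v n - U * V = (u n - U) * v n + U * (v n - V))%C by ring.
apply: Rle_lt_trans (Cmod_triangle _ _) _; rewrite !Cmod_mult.
have {}h1 : Cmod (u n - U) * (B + 1) < e / 2 by apply/Rlt_div_r => //; lra.
have {}h2 : Cmod (v n - V) * (Cmod U + 1) < e / 2 by apply/Rlt_div_r => //; lra.
have := hB n; have := Cmod_ge_0 (u n - U); have := Cmod_ge_0 (v n - V); nra.
Qed.

(** The product of the partial sums runs over a square of side N, the convolution over the pairs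
    below the hyperbola i j = N. For N >= K^2 the difference avoids the square of side K, so it is
    at most [P N - P K], a Cauchy tail. *)
Lemma Clim_conv (u v : nat -> C) (U V : C) (A B : R) :
  (forall N, \rsum_(1 <= n < N.+1) Cmod (u n) <= A) ->
  (forall N, \rsum_(1 <= n < N.+1) Cmod (v n) <= B) ->
  Clim (fun N => \csum_(1 <= n < N.+1) u n) U ->
  Clim (fun N => \csum_(1 <= n < N.+1) v n) V ->
  Clim (fun N => \csum_(1 <= n < N.+1) conv u v n) (U * V).
Proof.
move=> hA hB hU hV.
pose P N := \rsum_(1 <= i < N.+1) \rsum_(1 <= j < N.+1) (Cmod (u i) * Cmod (v j)).
have PE N : P N = (\rsum_(1 <= i < N.+1) Cmod (u i)) *
    (\rsum_(1 <= j < N.+1) Cmod (v j)).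
  by rewrite rsum_mull; apply: eq_bigr => i _; rewrite rsum_mulr.
have cc i j : 0 <= Cmod (u i) * Cmod (v j).
  by apply: Rmult_le_pos; apply: Cmod_ge_0.
have s0 (w : nat -> C) N : 0 <= \rsum_(1 <= n < N.+1) Cmod (w n).
  by apply: rsum_nat_ge0 => i _; apply: Cmod_ge_0.
have incr n m : (n <= m)%N -> P n <= P m.
  move=> nm; rewrite !PE; apply: Rmult_le_compat; try exact: s0.
    by apply: rsum_widen => // i _; apply: Cmod_ge_0.
  by apply: rsum_widen => // i _; apply: Cmod_ge_0.
have bd n : P n <= A * B by rewrite PE; apply: Rmult_le_compat.
have diff K N : (K * K <= N)%N -> Cmod (\csum_(1 <= n < N.+1) conv u v n -
    (\csum_(1 <= n < N.+1) u n) * (\csum_(1 <= n < N.+1) v n)) <= P N - P K.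
  move=> KN; rewrite -Cmod_opp.
  pose g := (fun p : pred nat => \csum_(1 <= i < N.+1)
    \csum_(1 <= j < N.+1 | p (i * j)%N) u i * v j)%C.
  pose q := (fun p : pred nat => \rsum_(1 <= i < N.+1)
    \rsum_(1 <= j < N.+1 | p (i * j)%N) (Cmod (u i) * Cmod (v j))).
  have gq p : Cmod (g p) <= q p.
    apply: Rle_trans (Cmod_csum _ _ _) _; apply: rsum_le => i _.
    apply: Rle_trans (Cmod_csum _ _ _) _; apply: rsum_le => j _.
    by rewrite Cmod_mult; lra.
  have e1 : (\csum_(1 <= n < N.+1) conv u v n)%C = g (fun k => (k <= N)%N).
    transitivity (\csum_(1 <= n < N.+1) conv u v n * 1)%C.
      by apply: eq_bigr => n _; rewrite Cmult_1_r.
    rewrite (sum_conv N u v (fun=> RtoC 1)); apply: eq_bigr => i _.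
    by apply: eq_bigr => j _; rewrite Cmult_1_r.
  have e2 : ((\csum_(1 <= n < N.+1) u n) * (\csum_(1 <= n < N.+1) v n) =
      g (fun k => (k <= N)%N) + g (fun k => ~~ (k <= N)%N))%C.
    rewrite csum_mull -csum_plus; apply: eq_bigr => i _.
    by rewrite csum_mulr (bigID (fun j => i * j <= N)%N).
  have e3 : P N = q (fun k => (k <= N)%N) + q (fun k => ~~ (k <= N)%N).
    rewrite /P -rsum_plus; apply: eq_bigr => i _.
    by rewrite (bigID (fun j => i * j <= N)%N).
  have e4 : P K <= q (fun k => (k <= N)%N).
    apply: Rle_trans (_ : \rsum_(1 <= i < K.+1) \rsum_(1 <= j < N.+1 |
      (i * j <= N)%N) (Cmod (u i) * Cmod (v j)) <= _); last first.
      by apply: rsum_widen => [|i _]; [nia | apply: rsum_ge0].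
    apply: rsum_nat_le => i hi; rewrite [X in _ <= X]big_mkcond.
    apply: Rle_trans (_ : \rsum_(1 <= j < K.+1) (if (i * j <= N)%N then
      Cmod (u i) * Cmod (v j) else 0) <= _).
      apply: rsum_nat_le => j hj; case: leqP; [lra | nia].
    by apply: rsum_widen => [|j _]; [nia | case: ifP => // _; lra].
  rewrite e1 e2; set x := g _; set y := g _.
  have -> : (- (x - (x + y)) = y)%C by ring.
  by have := gq (fun k => ~~ (k <= N)%N); rewrite -/y; lra.
have hUV := Clim_mult hU hV (fun n => Rle_trans _ _ _ (Cmod_csum _ _ _) (hB n)).
move=> e e0; have [|N1 H1] := hUV (e / 2); first lra.
have [|K HK] := bounded_incr_cauchy incr bd (_ : 0 < e / 2); first lra.
exists (maxn N1 (K * K)) => n; rewrite geq_max => /andP[/H1 h1 h2].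
have := diff _ _ h2; have := HK K n ltac:(nia).
move: h1; set x := (_ * _)%C; set w := (\csum_(_ <= _ < _) _)%C => h1 h3 h4.
have -> : (w - U * V = (w - x) + (x - U * V))%C by ring.
by have := Cmod_triangle (w - x) (x - U * V); lra.
Qed.

(** With x = Re s, |a_n| n^(-x) is at most |a_n|^2 + n^(-2x), and 2x > 1. *)
Lemma square_summable_abs (a : nat -> C) (s : C) : square_summable a ->
  1 / 2 < Re s ->
  exists B, forall N, \rsum_(1 <= n < N.+1) Cmod (a n * npow n s) <= B.
Proof.
move=> /square_summableP[B HB] hs; exists (B + (1 + / (2 * Re s - 1))) => N.
have h1 := @rsum_rpow (2 * Re s - 1) N ltac:(lra).
have := HB N; rewrite /nsq => h2.
suff : \rsum_(1 <= n < N.+1) Cmod (a n * npow n s) <=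
  \rsum_(1 <= n < N.+1) (Cmod (a n) ^ 2 + rpow n (1 + (2 * Re s - 1))).
  by rewrite rsum_plus; lra.
apply: rsum_le => n _; rewrite Cmod_mult Cmod_npow.
have -> : rpow n (1 + (2 * Re s - 1)) = rpow n (Re s) ^ 2.
  have -> : 1 + (2 * Re s - 1) = Re s + Re s by ring.
  by rewrite rpow_plus /=; ring.
have := pow2_ge_0 (Cmod (a n) - rpow n (Re s)).
have := pow2_ge_0 (Cmod (a n)); have := pow2_ge_0 (rpow n (Re s)).
rewrite /=; nra.
Qed.

(** The sum is chosen by [epsilon], with an arbitrary value for a divergent series; it is only
    consulted on half-planes of convergence. *)
Definition Csum (u : nat -> C) : C :=
  epsilon (inhabits (RtoC 0)) (Clim (fun N => \csum_(1 <= n < N.+1) u n)).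

Lemma CsumP (u : nat -> C) :
  (exists l, Clim (fun N => \csum_(1 <= n < N.+1) u n) l) ->
  Clim (fun N => \csum_(1 <= n < N.+1) u n) (Csum u).
Proof. exact: epsilon_spec. Qed.

Lemma square_summable_dirichlet (a : nat -> C) : square_summable a ->
  exists f, is_dirichlet_series (1 / 2) a f.
Proof.
move=> sa; exists (fun s => Csum (fun n => a n * npow n s)%C).
apply/is_dirichlet_seriesE => s hs; apply: CsumP.
have [B HB] := square_summable_abs sa hs; exact: abs_summable_Clim HB.
Qed.

Lemma dirichlet_mult (a b : nat -> C) (f g : C -> C) :
  square_summable a -> square_summable b ->
  is_dirichlet_series (1 / 2) a f -> is_dirichlet_series (1 / 2) b g ->
  is_dirichlet_series (1 / 2) (conv a b) (pointwise_mul f g).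
Proof.
move=> sa sb /is_dirichlet_seriesE hf /is_dirichlet_seriesE hg.
apply/is_dirichlet_seriesE => s hs.
have [A HA] := square_summable_abs sa hs.
have [B HB] := square_summable_abs sb hs.
apply: Clim_ext (Clim_conv HA HB (hf s hs) (hg s hs)) => N.
by apply: eq_bigr => n _; apply: conv_npow.
Qed.

Lemma Clim_bounded_terms (u : nat -> C) (l : C) :
  Clim (fun N => \csum_(1 <= n < N.+1) u n) l ->
  exists B, forall n, (1 <= n)%N -> Cmod (u n) <= B.
Proof.
move=> hl; have [N HN] := hl 1 Rlt_0_1.
exists (2 + \rsum_(1 <= n < N.+1) Cmod (u n)) => n n1.
have s0 : 0 <= \rsum_(1 <= n < N.+1) Cmod (u n).
  by apply: rsum_nat_ge0 => i _; apply: Cmod_ge_0.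
case: (leqP n N) => nN.
  have : \rsum_(1 <= i < N.+1) (if n == i then Cmod (u i) else 0) <=
    \rsum_(1 <= n < N.+1) Cmod (u n).
    apply: rsum_le => i _; have := Cmod_ge_0 (u i); case: ifP => _; lra.
  rewrite (bigD1_seq n) /=; [|by rewrite mem_index_iota; lia|exact: iota_uniq].
  rewrite eqxx big1 => [|i]; first lra.
  by rewrite eq_sym => /negbTE ->.
case: n n1 nN => // n _ nN; have := HN n nN; have := HN n.+1 (leqW nN).
rewrite csum_recr; set x := (\csum_(_ <= _ < _) _)%C => h1 h2.
have -> : (u n.+1 = (x + u n.+1 - l) - (x - l))%C by ring.
have := Cmod_triangle (x + u n.+1 - l) (- (x - l)); rewrite Cmod_opp /Cminus.
move: h1 h2; rewrite /Cminus; lra.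
Qed.

Lemma pow_dominated_eq0 (q x B : R) : 0 <= q < 1 ->
  0 <= x -> (forall k, x <= B * q ^ k) -> x = 0.
Proof.
move=> hq x0 h; apply: Rle_antisym => //; apply: le_epsilon => e e0.
have B0 : 0 <= B by have := h 0%N; rewrite /=; lra.
have q1 : Rabs q < 1 by rewrite Rabs_pos_eq; lra.
have e1 : 0 < e / (B + 1) by apply: Rdiv_lt_0_compat; lra.
have [N HN] := pow_lt_1_zero q q1 _ e1.
have := HN N (le_n N); have := h N.
rewrite Rabs_pos_eq; last by apply: pow_le; lra.
move=> h1 /(Rlt_div_r _ _ _ _) h2; have {}h2 : q ^ N * (B + 1) < e by apply: h2; lra.
have : 0 <= q ^ N by apply: pow_le; lra.
nra.
Qed.

(** Along real s tending to infinity the first non-zero term would dominate: its ratio to the tail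
    grows like ((n + 1) / n)^s. *)
Lemma dirichlet_coef_eq0 (a : nat -> C) :
  is_dirichlet_series (1 / 2) a (fun=> 0) ->
  forall n, (1 <= n)%N -> a n = 0.
Proof.
move=> /is_dirichlet_seriesE h; elim/ltn_ind => n IH n1.
have [B HB] := Clim_bounded_terms (h 1 ltac:(rewrite /half_plane /=; lra)).
have {}HB m : (1 <= m)%N -> Cmod (a m) <= B * INR m.
  move=> m1; have := HB m m1; rewrite Cmod_mult Cmod_npow /= rpow1 //.
  have mp := INR_pos m1; move/(Rmult_le_compat_r (INR m) _ _ (Rlt_le _ _ mp)).
  by rewrite Rmult_assoc Rinv_l; lra.
have B0 : 0 <= B by have := HB 1%N isT; have := Cmod_ge_0 (a 1%N); rewrite /=; lra.
have np := INR_pos n1; have np' : 0 < INR n.+1 by apply: INR_pos.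
apply: Cmod_eq_0; apply: (@pow_dominated_eq0 (INR n / INR n.+1) _
  (2 * B * INR n ^ 3)); last 1 first.
(* Since |a_i| <= B i, the shift 3 leaves the summable factor i^(-2), whose sum is at most 2; the
   remaining i^(-k) gives the decay (n + 1)^(-k) of the tail. *)
- move=> k; pose s := RtoC (INR k + 3).
  have hs : half_plane (1 / 2) s by rewrite /half_plane /=; have := pos_INR k; lra.
  have L := Clim_scal (- 1) (h s hs).
  have {}L := Clim_plus (Clim_const (a n * npow n s)) L.
  have bd N : (n <= N)%N -> Cmod (a n * npow n s + - 1 *
      \csum_(1 <= i < N.+1) a i * npow i s) <= 2 * B * rpow n.+1 (INR k).
    move=> nN; rewrite (@big_cat_nat _ _ _ n.+1 1 N.+1) /=; try lia.
    case: n n1 nN {np np' L} IH => // n _ nN IH; rewrite csum_recr.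
    rewrite big_nat big1 => [|i hi]; last by rewrite IH ?Cmult_0_l //; lia.
    set x := (_ * _)%C; set y := (\csum_(_ <= _ < _) _)%C.
    have -> : (x + - 1 * (0 + x + y) = - y)%C by ring.
    rewrite Cmod_opp; apply: Rle_trans (Cmod_csum _ _ _) _.
    apply: Rle_trans (_ : \rsum_(n.+2 <= i < N.+1)
      (B * rpow n.+2 (INR k) * rpow i (1 + 1)) <= _).
      apply: rsum_nat_le => i hi; rewrite Cmod_mult Cmod_npow /s /= !rpow_plus.
      have i1 : (1 <= i)%N by lia.
      change R1 with 1; rewrite !rpow1 //; have ip := INR_pos i1.
      have := HB i i1; have := @rpow_decr n.+2 i (INR k) isT ltac:(lia) (pos_INR k).
      have p1 := rpow_pos i (INR k); have p2 := Rinv_0_lt_compat _ ip => h1 h2.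
      apply: Rle_trans (Rmult_le_compat_r _ _ _ _ h2) _.
        by apply: Rmult_le_pos; [lra | nra].
      have -> : B * INR i * (rpow i (INR k) * (/ INR i * (/ INR i * / INR i))) =
        (B * (/ INR i * / INR i)) * rpow i (INR k) by field; lra.
      have -> : B * rpow n.+2 (INR k) * (/ INR i * / INR i) =
        (B * (/ INR i * / INR i)) * rpow n.+2 (INR k) by ring.
      apply: Rmult_le_compat_l => //; apply: Rmult_le_pos => //; nra.
    rewrite -rsum_mulr; have p := rpow_pos n.+2 (INR k).
    have -> : 2 * B * rpow n.+2 (INR k) = B * rpow n.+2 (INR k) * (1 + / 1).
      by field.
    apply: Rmult_le_compat_l; first by nra.
    apply: Rle_trans (@rsum_rpow 1 N Rlt_0_1).
    rewrite [X in _ <= X](@big_cat_nat _ _ _ n.+2 1 N.+1) /=; try lia.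
    have : 0 <= \rsum_(1 <= i < n.+2) rpow i (1 + 1).
      by apply: rsum_nat_ge0 => i _; apply: Rlt_le (rpow_pos _ _).
    lra.
  have := Clim_Cmod_le L bd; rewrite Cmult_0_r Cplus_0_r Cmod_mult Cmod_npow.
  have e3 : rpow n 3 = (/ INR n) ^ 3.
    by rewrite -(rpow_INR 3 n1); congr rpow; rewrite /=; ring.
  rewrite (_ : Re s = INR k + 3) // rpow_plus e3 !rpow_INR // => h1.
  have h2 : 0 < INR n ^ k * INR n ^ 3 by apply: Rmult_lt_0_compat; apply: pow_lt.
  have := Rmult_le_compat_r _ _ _ (Rlt_le _ _ h2) h1.
  rewrite !pow_inv /Rdiv Rpow_mult_distr pow_inv.
  have nk : INR n ^ k <> 0 by apply: pow_nonzero; lra.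
  have n'k : INR n.+1 ^ k <> 0 by apply: pow_nonzero; lra.
  have -> : Cmod (a n) * (/ INR n ^ k * / INR n ^ 3) * (INR n ^ k * INR n ^ 3) =
    Cmod (a n) by field; split => //; lra.
  move=> h3; apply: Rle_trans h3 _; right; by field.
- split; first by apply: Rlt_le; apply: Rdiv_lt_0_compat.
  by apply/Rlt_div_l => //; rewrite S_INR; lra.
- exact: Cmod_ge_0.
Qed.

Lemma dirichlet_coef_unique (a b : nat -> C) (f : C -> C) :
  is_dirichlet_series (1 / 2) a f -> is_dirichlet_series (1 / 2) b f ->
  forall n, (1 <= n)%N -> a n = b n.
Proof.
move=> /is_dirichlet_seriesE ha /is_dirichlet_seriesE hb n n1.
suff h : (a n + - 1 * b n = 0)%C.
  have -> : (a n = (a n + - 1 * b n) + b n)%C by ring.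
  by rewrite h Cplus_0_l.
apply: (@dirichlet_coef_eq0 (fun n => a n + - 1 * b n)%C) => //.
apply/is_dirichlet_seriesE => s hs.
have := Clim_plus (ha s hs) (Clim_scal (- 1) (hb s hs)).
have -> : (f s + - 1 * f s = 0)%C by ring.
apply: Clim_ext => N; rewrite csum_mulr -csum_plus.
by apply: eq_bigr => i _; ring.
Qed.

(** * Abel summation and Riesz means *)

Lemma Cmod_le_sq (z : C) (r : R) : 0 <= r ->
  Re z ^ 2 + Im z ^ 2 <= r ^ 2 -> Cmod z <= r.
Proof.
by move=> r0 h; rewrite -(sqrt_pow2 r r0); apply: sqrt_le_1_alt.
Qed.

Lemma Cmod_sq (z : C) : Cmod z ^ 2 = Re z ^ 2 + Im z ^ 2.
Proof.
rewrite /Cmod pow2_sqrt //; apply: Rplus_le_le_0_compat; exact: pow2_ge_0.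
Qed.

Lemma Rabs_sin_le (x : R) : Rabs (sin x) <= Rabs x.
Proof.
have pos y : 0 <= y -> Rabs (sin y) <= y.
  move=> y0; case: (Rle_lt_dec y PI) => h.
    rewrite Rabs_pos_eq; last by apply: sin_ge_0.
    by case: y0 => [/sin_lt_x|<-]; [lra | rewrite sin_0; lra].
  have := SIN_bound y; have := PI2_1; rewrite /PI2 => *.
  apply: Rle_trans (_ : 1 <= _); last by lra.
  by apply: Rabs_le; lra.
case: (Rle_lt_dec 0 x) => h; first by rewrite (Rabs_pos_eq x) //; apply: pos.
by rewrite -Rabs_Ropp -sin_neg (Rabs_left x) //; apply: pos; lra.
Qed.

(** A chord is at most its arc: the squared chord is 4 sin^2((u - v) / 2). *)
Lemma Cmod_Cexp_sub (u v : R) :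
  Cmod (Cexp (0, u) - Cexp (0, v)) <= Rabs (u - v).
Proof.
apply: Cmod_le_sq; first exact: Rabs_pos.
rewrite /Cexp /Re /Im /= exp_0.
have -> : Rabs (u - v) * (Rabs (u - v) * 1) = 4 * Rsqr ((u - v) / 2).
  by rewrite Rmult_1_r -/(Rsqr _) -Rsqr_abs /Rsqr; field.
have h : Rsqr (sin ((u - v) / 2)) <= Rsqr ((u - v) / 2).
  by apply: Rsqr_le_abs_1; apply: Rabs_sin_le.
apply: Rle_trans (_ : 4 * Rsqr (sin ((u - v) / 2)) <= _); last by lra.
have e : cos (u - v) = 1 - 2 * Rsqr (sin ((u - v) / 2)).
  have {1}-> : u - v = 2 * ((u - v) / 2) by field.
  by rewrite cos_2a_sin /Rsqr; ring.
rewrite cos_minus in e; have := sin2_cos2 u; have := sin2_cos2 v.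
rewrite /Rsqr in e *; nra.
Qed.

Lemma npow_real n x : npow n (RtoC x) = RtoC (rpow n x).
Proof.
rewrite /npow -RtoC_opp -RtoC_mult /Cexp /= cos_0 sin_0.
by rewrite -/(RtoC 1) Cmult_1_r.
Qed.

Lemma npow_split n s : npow n s = (RtoC (rpow n (Re s)) * npow n (0, Im s))%C.
Proof.
rewrite -npow_real -npow_plus; congr npow.
by case: s => x y; rewrite /Cplus /RtoC /=; congr pair; ring.
Qed.

Lemma npow_imag n t : npow n (0, t) = Cexp (0, - t * ln (INR n)).
Proof. by rewrite /npow /Cmult /Copp /RtoC /=; congr (Cexp (_, _)); ring. Qed.

(** Rotation contributes at most |Im s| log((n + 1) / n), which [rpow_sub] converts into the
    decrease of n^(-Re s). The bound therefore telescopes over n. *)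
Lemma Cmod_npow_sub (n : nat) (s : C) : (1 <= n)%N -> 0 < Re s ->
  Cmod (npow n s - npow n.+1 s) <=
  (1 + Rabs (Im s) / Re s) * (rpow n (Re s) - rpow n.+1 (Re s)).
Proof.
move=> n1 s0; rewrite (npow_split n) (npow_split n.+1).
set u := npow n _; set v := npow n.+1 _; set x := rpow n _; set y := rpow n.+1 _.
have -> : (x * u - y * v = (x - y) * u + y * (u - v))%C by ring.
have yx : y <= x by apply: rpow_decr => //; lra.
have y0 : 0 < y := rpow_pos _ _.
have -> : (x - y)%C = RtoC (x - y) by rewrite RtoC_minus.
apply: Rle_trans (Cmod_triangle _ _) _.
rewrite (Cmod_mult _ u) (Cmod_mult y) !Cmod_R.
rewrite (Rabs_pos_eq y) ?(Rabs_pos_eq (x - y)); try lra.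
have -> : Cmod u = 1 by rewrite Cmod_npow /= rpown0.
have h : Cmod (u - v) <= Rabs (Im s) * (ln (INR n.+1) - ln (INR n)).
  rewrite /u /v !npow_imag; apply: Rle_trans (Cmod_Cexp_sub _ _) _.
  have -> : - Im s * ln (INR n) - - Im s * ln (INR n.+1) =
    Im s * (ln (INR n.+1) - ln (INR n)) by ring.
  rewrite Rabs_mult (Rabs_pos_eq (_ - _)); first by lra.
  by have := ln_S_sub n1; have := Rinv_0_lt_compat _ (INR_pos (ltn0Sn n)); lra.
have h2 := rpow_sub (Re s) n1; rewrite -/x -/y in h2.
move: h h2; set d := ln _ - ln _ => h h2; have t0 := Rabs_pos (Im s).
have : y * Cmod (u - v) <= Rabs (Im s) / Re s * (x - y).
  apply: Rle_trans (_ : y * (Rabs (Im s) * d) <= _).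
    by apply: Rmult_le_compat_l; lra.
  have -> : y * (Rabs (Im s) * d) = Rabs (Im s) / Re s * (Re s * d * y).
    by field; lra.
  apply: Rmult_le_compat_l => //; apply: Rmult_le_pos => //.
  by apply: Rlt_le; apply: Rinv_0_lt_compat.
by lra.
Qed.

(** Abel summation. Half of the decay n^(-Re s) pays for the growth allowed to the partial sums, the
    other half remains as a rate in the starting index. The dependence on Im s is kept explicit
    because the tails are later used on long vertical segments. *)
Lemma abel_bound (b : nat -> C) (p : nat) (s : C) (D : R) :
  (1 <= p)%N -> 0 < Re s -> 0 <= D ->
  (forall m, Cmod (\csum_(p <= i < (p + m).+1) b i) <=
     D * rpow (p + m) (- (Re s / 2))) ->
  forall m, Cmod (\csum_(p <= i < p + m) b i * npow i s) <=
    2 * D * (1 + Rabs (Im s) / Re s) * rpow p (Re s / 2).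
Proof.
move=> p1 s0 D0 hB m; set c := 1 + _.
have c1 : 1 <= c.
  rewrite /c; have : 0 <= Rabs (Im s) / Re s; last by lra.
  by apply: Rmult_le_pos (Rabs_pos _) _; apply: Rlt_le; apply: Rinv_0_lt_compat.
have Dc : 0 <= D * c by apply: Rmult_le_pos; lra.
set y := fun n => rpow n (Re s / 2).
have y0 n : 0 < y n := rpow_pos _ _.
have yE n : rpow n (Re s) = y n ^ 2.
  by rewrite {1}(_ : Re s = Re s / 2 + Re s / 2) ?rpow_plus /y /=; [ring | field].
have yI n : rpow n (- (Re s / 2)) * y n = 1.
  by rewrite /y -rpow_plus Rplus_opp_l rpown0.
have ydecr n : (1 <= n)%N -> y n.+1 <= y n by move=> n1; apply: rpow_decr => //; lra.
have key k : Cmod (\csum_(p <= i < p + k) b i * npow i s -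
    (\csum_(p <= i < p + k) b i) * npow (p + k) s) <=
    2 * D * c * (y p - y (p + k)%N).
  elim: k => [|k IH].
    by rewrite addn0 !big_geq // Cmult_0_l /Cminus Cplus_0_l Cmod_opp Cmod_0; lra.
  have Bk := hB k; rewrite addnS.
  rewrite [X in Cmod (X - _)]big_nat_recr ?leq_addr //=.
  set W := (\csum_(_ <= _ < _) _ * npow _ _)%C in IH *.
  set B := (\csum_(_ <= _ < _) _)%C in Bk *.
  have eB : B = ((\csum_(p <= i < p + k) b i) + b (p + k)%N)%C.
    by rewrite /B big_nat_recr ?leq_addr.
  move: IH; set B' := (\csum_(_ <= _ < _) _)%C in eB * => IH.
  set n := (p + k)%N in Bk eB IH *.
  have -> : (W + b n * npow n s - B * npow n.+1 s =
    (W - B' * npow n s) + B * (npow n s - npow n.+1 s))%C by rewrite eB; ring.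
  apply: Rle_trans (Cmod_triangle _ _) _; rewrite Cmod_mult.
  have n1 : (1 <= n)%N by rewrite /n; lia.
  have hd := Cmod_npow_sub n1 s0; rewrite -/c !yE in hd.
  have h1 : Cmod B * Cmod (npow n s - npow n.+1 s) <=
     D * rpow n (- (Re s / 2)) * (c * (y n ^ 2 - y n.+1 ^ 2)).
    by apply: Rmult_le_compat => //; apply: Cmod_ge_0.
  have r0 : 0 < rpow n (- (Re s / 2)) := rpow_pos _ _.
  (* In the difference of squares the factor y_n + y_(n+1) is at most 2 y_n, which cancels the
     growth of the partial sums; a telescoping difference is left. *)
  have h2 : rpow n (- (Re s / 2)) * (y n ^ 2 - y n.+1 ^ 2) <= 2 * (y n - y n.+1).
    have -> : y n ^ 2 - y n.+1 ^ 2 = (y n - y n.+1) * (y n + y n.+1) by ring.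
    have := ydecr n n1; have := yI n; have := y0 n.+1; have := y0 n => h3 h4 h5 h6.
    have : rpow n (- (Re s / 2)) * (y n + y n.+1) <= 2 by nra.
    by nra.
  have h3 := Rmult_le_compat_l (D * c) _ _ Dc h2.
  by lra.
case: m => [|m].
  rewrite addn0 big_geq // Cmod_0.
  by apply: Rmult_le_pos; [lra | apply: Rlt_le (rpow_pos _ _)].
have := key m.+1; have := hB m; rewrite !addnS.
set B := (\csum_(_ <= _ < _) b _)%C; set W := (\csum_(_ <= _ < _) _)%C => h1 h2.
have -> : (W = (W - B * npow (p + m).+1 s) + B * npow (p + m).+1 s)%C by ring.
apply: Rle_trans (Cmod_triangle _ _) _; rewrite Cmod_mult Cmod_npow yE -/(y p).
set n := (p + m)%N in h1 h2 *.
have n1 : (1 <= n)%N by rewrite /n; lia.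
have := ydecr n n1; have := yI n; have := y0 n.+1; have := y0 n.
move=> y1 y2 y3 y4; have r0 : 0 < rpow n (- (Re s / 2)) := rpow_pos _ _.
have h3 : Cmod B * y n.+1 ^ 2 <= D * rpow n (- (Re s / 2)) * y n.+1 ^ 2.
  by apply: Rmult_le_compat_r => //; apply: pow2_ge_0.
have h4 : rpow n (- (Re s / 2)) * y n.+1 ^ 2 <= y n.+1 by rewrite /=; nra.
have h5 := Rmult_le_compat_l D _ _ D0 h4.
have Dy : 0 <= D * y n.+1 by apply: Rmult_le_pos; lra.
have h6 := Rmult_le_compat_l (D * y n.+1) _ _ Dy c1.
by lra.
Qed.

Lemma rpow_lim0 (x eps : R) : 0 < x -> 0 < eps ->
  exists N, (1 <= N)%N /\ forall n, (N <= n)%N -> rpow n x < eps.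
Proof.
move=> x0 e0; have [K HK] := nfloor_ex (exp (- ln eps / x)) (Rlt_le _ _ (exp_pos _)).
exists K.+1; split=> // n hn.
rewrite -(exp_ln eps e0); apply: exp_increasing.
have n0 : 0 < INR n by apply: INR_pos; lia.
have : - ln eps / x < ln (INR n).
  rewrite -(ln_exp (- ln eps / x)); apply: ln_increasing; first exact: exp_pos.
  have := le_INR K.+1 n ltac:(lia); rewrite S_INR; lra.
move/(Rmult_lt_compat_r x _ _ x0); rewrite /Rdiv Rmult_assoc Rinv_l; lra.
Qed.

Lemma ln_le_rpow (n : nat) (x : R) : 0 < x -> ln (INR n) <= / x * rpow n (- x).
Proof.
move=> x0; have := exp_ineq1_le (x * ln (INR n)).
rewrite /rpow Ropp_involutive => h.
have ix : 0 < / x by apply: Rinv_0_lt_compat.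
have := Rmult_le_compat_l _ _ _ (Rlt_le _ _ ix) h.
by rewrite Rmult_plus_distr_l -Rmult_assoc Rinv_l; lra.
Qed.

Lemma ln_unbounded (B : R) : exists N, (1 <= N)%N /\
  forall n, (N <= n)%N -> B < ln (INR n).
Proof.
have [K HK] := nfloor_ex (exp B) (Rlt_le _ _ (exp_pos _)).
exists K.+1; split=> // n hn; rewrite -(ln_exp B); apply: ln_increasing.
  exact: exp_pos.
have := le_INR K.+1 n ltac:(lia); rewrite S_INR; lra.
Qed.

(** By Abel summation the Riesz mean is the average of the partial sums with weights log((n + 1) /
    n), of total mass log N; since log N is unbounded, the averages converge as Cesàro means do. *)
Lemma riesz_mean_Clim (b : nat -> C) (l : C) :
  Clim (fun N => \csum_(1 <= n < N.+1) b n) l ->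
  Clim (fun N => \csum_(1 <= n < N.+1) RtoC (1 - ln (INR n) / ln (INR N)) * b n) l.
Proof.
move=> hl; pose B N := (\csum_(1 <= n < N.+1) b n)%C.
pose d n := ln (INR n.+1) - ln (INR n).
have d0 n : (1 <= n)%N -> 0 <= d n.
  move=> n1; have := ln_S_sub n1; have := Rinv_0_lt_compat _ (INR_pos (ltn0Sn n)).
  by rewrite /d; lra.
have abel N : (\csum_(1 <= n < N.+1) (RtoC (ln (INR N.+1) - ln (INR n)) * b n) -
    RtoC (ln (INR N.+1)) * l = \csum_(1 <= n < N.+1) RtoC (d n) * (B n - l))%C.
  elim: N => [|N IH].
    by rewrite !big_geq //= ln_1; ring.
  rewrite [RHS]csum_recr -IH {1}(csum_recr N).
  have -> : (\csum_(1 <= n < N.+1) (RtoC (ln (INR N.+2) - ln (INR n)) * b n) =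
    (\csum_(1 <= n < N.+1) (RtoC (ln (INR N.+1) - ln (INR n)) * b n)) +
     RtoC (d N.+1) * B N)%C.
    rewrite /B csum_mulr -csum_plus; apply: eq_bigr => n _.
    by rewrite /d !RtoC_minus; ring.
  by rewrite /B csum_recr /d !RtoC_minus; ring.
have tele N : \rsum_(1 <= n < N.+1) d n = ln (INR N.+1).
  elim: N => [|N IH]; first by rewrite big_geq //= ln_1.
  by rewrite rsum_recr IH /d; ring.
move=> e e0; have [|N0 H0] := hl (e / 2); first lra.
pose K := \rsum_(1 <= n < N0.+1) (d n * Cmod (B n - l)).
have [N1 [N11 H1]] := ln_unbounded (Rmax 1 (K / (e / 2))).
exists (maxn N0.+2 N1).+1 => -[|N]; first by rewrite ltn0.
rewrite ltnS geq_max => /andP[hN0 hN1].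
have L0 := H1 N.+1 (leqW hN1); have := Rmax_l 1 (K / (e / 2)).
have := Rmax_r 1 (K / (e / 2)) => m1 m2.
set L := ln (INR N.+1) in L0 *; have Lp : 0 < L by lra.
have -> : (\csum_(1 <= n < N.+2) (RtoC (1 - ln (INR n) / L) * b n) - l =
   RtoC (/ L) * (\csum_(1 <= n < N.+1) RtoC (d n) * (B n - l)))%C.
  rewrite -abel -/L csum_recr -/L.
  (* The last term has weight zero, so the sum stops one index earlier, as in [abel]. *)
  have -> : 1 - L / L = 0 by field; lra.
  rewrite Cmult_0_l Cplus_0_r.
  have {1}-> : l = (RtoC (/ L) * (RtoC L * l))%C.
    by rewrite Cmult_assoc -RtoC_mult Rinv_l ?Cmult_1_l //; lra.
  rewrite /Cminus Cmult_plus_distr_l; congr Cplus; last by ring.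
  rewrite csum_mulr; apply: eq_bigr => n _; rewrite Cmult_assoc -RtoC_mult.
  by congr (RtoC _ * _)%C; field; lra.
rewrite Cmod_mult Cmod_R Rabs_pos_eq; last by apply: Rlt_le; apply: Rinv_0_lt_compat.
suff h : Cmod (\csum_(1 <= n < N.+1) RtoC (d n) * (B n - l)) <= K + e / 2 * L.
  apply: Rle_lt_trans (Rmult_le_compat_l _ _ _ _ h) _.
    by apply: Rlt_le; apply: Rinv_0_lt_compat.
  have h2 : K < e / 2 * L by rewrite Rmult_comm; apply/Rlt_div_l; lra.
  rewrite Rmult_comm; apply/Rlt_div_l => //; lra.
apply: Rle_trans (Cmod_csum _ _ _) _.
apply: Rle_trans (_ : \rsum_(1 <= n < N.+1) (d n * Cmod (B n - l)) <= _).
  apply: rsum_nat_le => n /andP[n1 _].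
  by rewrite Cmod_mult Cmod_R Rabs_pos_eq; [lra | apply: d0].
rewrite (@big_cat_nat _ _ _ N0.+1 1 N.+1) /=; try lia.
rewrite -/K; apply: Rplus_le_compat_l.
apply: Rle_trans (_ : \rsum_(N0.+1 <= n < N.+1) (e / 2 * d n) <= _).
  apply: rsum_nat_le => n hn; rewrite Rmult_comm.
  apply: Rmult_le_compat_r; first by apply: d0; lia.
  by apply: Rlt_le; apply: H0; lia.
rewrite -rsum_mulr; apply: Rmult_le_compat_l; first lra.
rewrite /L -tele [X in _ <= X](@big_cat_nat _ _ _ N0.+1 1 N.+1) /=; try lia.
have : 0 <= \rsum_(1 <= i < N0.+1) d i by apply: rsum_nat_ge0 => i /andP[/d0].
by lra.
Qed.

(** * Schur multipliers by tents *)

Definition mult_bound (A : nat -> Prop) (a : nat -> C) (Q : R) : Prop :=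
  forall b, supported_in A b ->
  forall N, nsq N (conv a b) <= Q ^ 2 * nsq N b.

(** The operator bound as a bilinear form, with the product of the norms replaced by half the sum of
    their squares. This can be added up over families of pairs (b, d), as the overlap argument for
    tents requires, and combines linearly in [a]. *)
Definition form_bound (A : nat -> Prop) (a : nat -> C) (Q : R) : Prop :=
  forall b, supported_in A b -> forall d N,
  2 * Cmod (\csum_(1 <= n < N.+1) conv a b n * d n) <= Q * (nsq N b + nsq N d).

Lemma mult_form_bound A a Q : 0 < Q -> mult_bound A a Q -> form_bound A a Q.
Proof.
move=> Q0 h b sb d N.
apply: Rle_trans (_ : \rsum_(1 <= n < N.+1)
  (/ Q * Cmod (conv a b n) ^ 2 + Q * Cmod (d n) ^ 2) <= _).
  apply: Rle_trans (Rmult_le_compat_l _ _ _ _ (Cmod_csum _ _ _)) _; first lra.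
  rewrite rsum_mulr; apply: rsum_le => n _; rewrite Cmod_mult.
  have := pow2_ge_0 (Cmod (conv a b n) - Q * Cmod (d n)).
  move/(Rmult_le_compat_l (/ Q) _ _ (Rlt_le _ _ (Rinv_0_lt_compat _ Q0))).
  have -> : / Q * (Cmod (conv a b n) - Q * Cmod (d n)) ^ 2 =
    / Q * Cmod (conv a b n) ^ 2 + Q * Cmod (d n) ^ 2
    - 2 * (Cmod (conv a b n) * Cmod (d n)) by field; lra.
  lra.
rewrite rsum_plus -!rsum_mulr -/(nsq N _) -/(nsq N _).
have := Rmult_le_compat_l _ _ _ (Rlt_le _ _ (Rinv_0_lt_compat _ Q0)) (h b sb N).
have -> : / Q * (Q ^ 2 * nsq N b) = Q * nsq N b by field; lra.
lra.
Qed.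

Lemma form_mult_bound A a Q : 0 < Q -> form_bound A a Q -> mult_bound A a Q.
Proof.
move=> Q0 h b sb N; set X := nsq N (conv a b).
(* Duality: the output is tested against its own conjugate. The factor [/ Q] balances the two
   squares, so that the right side absorbs exactly half of [2 * X]. *)
have := h b sb (fun n => RtoC (/ Q) * Cconj (conv a b n))%C N.
have -> : nsq N (fun n => RtoC (/ Q) * Cconj (conv a b n))%C = / Q ^ 2 * X.
  rewrite /X /nsq rsum_mulr; apply: eq_bigr => n _.
  rewrite Cmod_mult Cmod_R Cmod_conj Rpow_mult_distr pow2_abs.
  by congr (_ * _); field; lra.
have -> : (\csum_(1 <= n < N.+1) conv a b n *
    (RtoC (/ Q) * Cconj (conv a b n)) = RtoC (/ Q * X))%C.
  rewrite RtoC_mult /X /nsq RtoC_rsum csum_mulr; apply: eq_bigr => n _.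
  by rewrite Cmod2_conj; ring.
rewrite Cmod_R Rabs_pos_eq; last first.
  by apply: Rmult_le_pos (nsq_ge0 _ _); apply: Rlt_le; apply: Rinv_0_lt_compat.
move/(Rmult_le_compat_l Q _ _ (Rlt_le _ _ Q0)).
have -> : Q * (2 * (/ Q * X)) = 2 * X by field; lra.
have -> : Q * (Q * (nsq N b + / Q ^ 2 * X)) = Q ^ 2 * nsq N b + X by field; lra.
lra.
Qed.

Lemma form_bound_le A a Q Q' : Q <= Q' -> form_bound A a Q -> form_bound A a Q'.
Proof.
move=> QQ h b sb d N; apply: Rle_trans (h b sb d N) _.
by apply: Rmult_le_compat_r => //; have := nsq_ge0 N b; have := nsq_ge0 N d; lra.
Qed.

Lemma form_bound_ext A a a' Q : (forall n, (1 <= n)%N -> a n = a' n) ->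
  form_bound A a Q -> form_bound A a' Q.
Proof.
move=> e h b sb d N; have := h b sb d N; rewrite !sum_conv.
suff -> : (\csum_(1 <= i < N.+1) \csum_(1 <= j < N.+1 | (i * j <= N)%N)
    a i * b j * d (i * j)%N = \csum_(1 <= i < N.+1)
    \csum_(1 <= j < N.+1 | (i * j <= N)%N) a' i * b j * d (i * j)%N)%C by [].
by apply: eq_big_nat => i /andP[i1 _]; rewrite e.
Qed.

Lemma form_bound_lin A a a' Q Q' (x y : R) : form_bound A a Q ->
  form_bound A a' Q' ->
  form_bound A (fun n => RtoC x * a n + RtoC y * a' n)%C (Rabs x * Q + Rabs y * Q').
Proof.
move=> h h' b sb d N; have := h b sb d N; have := h' b sb d N; rewrite !sum_conv.
set S' := (\csum_(1 <= i < N.+1) _)%C; set S := (\csum_(1 <= i < N.+1) _)%C.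
set T := (\csum_(1 <= i < N.+1) _)%C; have -> : (T = RtoC x * S + RtoC y * S')%C.
  rewrite /T /S /S' !csum_mulr -csum_plus; apply: eq_bigr => i _.
  rewrite !csum_mulr -csum_plus; apply: eq_bigr => j _; ring.
move=> h1 h2; have := Cmod_triangle (RtoC x * S) (RtoC y * S').
rewrite !Cmod_mult !Cmod_R.
have := Rmult_le_compat_l _ _ _ (Rabs_pos x) h2.
have := Rmult_le_compat_l _ _ _ (Rabs_pos y) h1.
lra.
Qed.

Definition tent (h c x : R) : R := Rmax 0 (1 - Rabs (x - c) / h).

Lemma floor_fun (x : nat -> R) : (forall n, (1 <= n)%N -> 0 <= x n) ->
  exists p : nat -> nat, forall n, (1 <= n)%N -> INR (p n) <= x n < INR (p n) + 1.
Proof.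
move=> h; exists (fun n => match Rle_dec 0 (x n) with
  left h => proj1_sig (nfloor_ex _ h) | right _ => 0%N end) => n n1.
case: Rle_dec => [h'|]; last by have := h n n1.
exact: (proj2_sig (nfloor_ex _ h')).
Qed.

Lemma rsum_window (q r J : nat) :
  \rsum_(0 <= j < J) (if (q <= j < r)%N then 1 else 0) = INR (minn r J - q).
Proof.
elim: J => [|J IH]; first by rewrite big_geq // minn0.
have -> : \rsum_(0 <= j < J.+1) (if (q <= j < r)%N then 1 else 0) =
  \rsum_(0 <= j < J) (if (q <= j < r)%N then 1 else 0) +
  (if (q <= J < r)%N then 1 else 0) by exact: big_nat_recr.
rewrite IH; case: ifP => h; last by rewrite Rplus_0_r; congr INR; lia.
by rewrite -S_INR; congr INR; lia.
Qed.

(** Rounding both left ends down to the grid changes their distance, and so the overlap, by at most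
    one cell. *)
Lemma window_overlap (p q H : nat) (x y : R) :
  INR p <= x < INR p + 1 -> INR q <= y < INR q + 1 -> (0 < H)%N ->
  Rabs (INR (minn (p + H) (q + H) - maxn p q) -
        INR H * Rmax 0 (1 - Rabs (x - y) / INR H)) <= 1.
Proof.
move=> hp hq H0; have Hp := INR_pos H0.
have -> : INR H * Rmax 0 (1 - Rabs (x - y) / INR H) =
    Rmax 0 (INR H - Rabs (x - y)).
  rewrite -RmaxRmult; last lra.
  by congr Rmax; [ring | field; lra].
have -> : INR (minn (p + H) (q + H) - maxn p q) =
    Rmax 0 (INR H - Rabs (INR p - INR q)).
  wlog pq : p q x y hp hq / (p <= q)%N.
    move=> h; case/orP: (leq_total p q) => pq; first exact: (h p q x y).
    by rewrite minnC maxnC Rabs_minus_sym; apply: (h q p y x).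
  have pqR := le_INR p q ltac:(lia).
  rewrite (Rabs_left1 (INR p - INR q)); last lra.
  case: (leqP q (p + H)) => h.
    have hR := le_INR q (p + H) ltac:(lia); rewrite plus_INR in hR.
    rewrite Rmax_right; last lra.
    have -> : (minn (p + H) (q + H) - maxn p q = (p + H) - q)%N by lia.
    by rewrite minus_INR ?plus_INR; [lra | lia].
  have hR := le_INR (p + H) q ltac:(lia); rewrite plus_INR in hR.
  rewrite Rmax_left; last lra.
  by have -> : (minn (p + H) (q + H) - maxn p q = 0)%N by lia.
have h1 : Rabs (Rabs (INR p - INR q) - Rabs (x - y)) <= 1.
  apply: Rle_trans (Rabs_triang_inv2 _ _) _; apply: Rabs_le; lra.
move: h1; set u := Rabs (INR p - _); set v := Rabs (x - y).
by move/Rabs_le_between => h1; rewrite /Rmax; do 2 case: Rle_dec => ?;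
   apply: Rabs_le; lra.
Qed.

(* Up to the factor [h], [tent h c (x - y)] is the length of the overlap of
   [[x, x + h]] and [[y + c, y + c + h]], that is, an inner product of a unit
   vector indexed by [x] with one indexed by [y]; hence it is a contractive Schur
   multiplier. The overlaps are measured on a grid of mesh [h / H], [H -> oo]. *)
Lemma form_bound_tent A a Q h c : 0 <= Q -> 0 < h -> 0 <= c ->
  form_bound A a Q ->
  form_bound A (fun n => RtoC (tent h c (ln (INR n))) * a n)%C Q.
Proof.
move=> Q0 h0 c0 ha b sb d N; rewrite sum_conv.
set T := (\csum_(_ <= _ < _) _)%C.
(* Each matrix entry will be off by at most one grid cell, so [K] bounds the total error for every
   mesh; division by [INR H] makes it vanish. *)
pose K := \rsum_(1 <= i < N.+1) \rsum_(1 <= j < N.+1 | (i * j <= N)%N)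
  Cmod (a i * b j * d (i * j)%N).
have K0 : 0 <= K.
  by apply: rsum_ge0 => i _; apply: rsum_ge0 => j _; apply: Cmod_ge_0.
suff main H : (0 < H)%N ->
    2 * (INR H * Cmod T) <= Q * INR H * (nsq N b + nsq N d) + 2 * K.
  apply: le_epsilon => e e0.
  have [H hH] := nfloor_ex (2 * K / e) ltac:(by apply: Rdiv_le_0_compat; lra).
  have := main H.+1 isT; have Hp : 0 < INR H.+1 by apply: INR_pos.
  have h2 : 2 * K < INR H.+1 * e.
    apply/(Rlt_div_l _ _ _ e0); rewrite S_INR; lra.
  move=> h3; apply: (Rmult_le_reg_l (INR H.+1)) => //; lra.
move=> H0; have Hp := INR_pos H0; pose t := INR H / h.
have t0 : 0 < t by apply: Rdiv_lt_0_compat.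
(* With [t] cells per unit, a window of [H] cells has length [h]. [p] places the output index on the
   grid, [q] the input index shifted by [c]. *)
have [p hp] := @floor_fun (fun n => t * ln (INR n))
  (fun n n1 => Rmult_le_pos _ _ (Rlt_le _ _ t0) (ln_ge0 n1)).
have [q hq] := @floor_fun (fun n => t * (ln (INR n) + c))
  (fun n n1 => Rmult_le_pos _ _ (Rlt_le _ _ t0)
     (Rplus_le_le_0_compat _ _ (ln_ge0 n1) c0)).
(* The grid covers every output window. Input windows may stick out, but only their overlaps with
   output windows count. *)
pose J := (p N + H)%N.
have pJ n : (1 <= n <= N)%N -> (p n + H <= J)%N.
  move=> /andP[n1 nN]; rewrite leq_add2r.
  have [h1 _] := hp n n1; have [_ h2] := hp N ltac:(lia).
  have h3 : ln (INR n) <= ln (INR N).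
    by apply: ln_le; [apply: INR_pos | apply: le_INR; lia].
  have h4 := Rmult_le_compat_l t _ _ (Rlt_le _ _ t0) h3.
  have : INR (p n) < INR (p N).+1 by rewrite S_INR; lra.
  by move/INR_lt; lia.
pose v (f : nat -> nat) (j n : nat) := if (f n <= j < f n + H)%N then 1 else 0.
have v01 f j n : v f j n ^ 2 = v f j n.
  by rewrite /v; case: ifP => _; ring.
have vsum (f : nat -> nat) (e : nat -> C) : \rsum_(0 <= j < J)
    nsq N (fun n => e n * RtoC (v f j n))%C <= INR H * nsq N e.
  rewrite /nsq exchange_big rsum_mulr; apply: rsum_le => n _.
  rewrite (eq_bigr (fun j => Cmod (e n) ^ 2 * v f j n)); last first.
    by move=> j _; rewrite Cmod_mult Cmod_R Rpow_mult_distr pow2_abs v01.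
  rewrite -rsum_mulr Rmult_comm; apply: Rmult_le_compat_r; first exact: pow2_ge_0.
  by rewrite rsum_window; apply: le_INR; lia.
pose G i j := INR (minn (p (i * j)%N + H) (q j + H) - maxn (p (i * j)%N) (q j)).
have GE : (\csum_(0 <= k < J) \csum_(1 <= n < N.+1)
    conv a (fun n => b n * RtoC (v q k n)) n * (d n * RtoC (v p k n)) =
    \csum_(1 <= i < N.+1) \csum_(1 <= j < N.+1 | (i * j <= N)%N)
    a i * b j * d (i * j)%N * RtoC (G i j))%C.
  rewrite (eq_bigr _ (fun k _ => sum_conv N a _ _)) exchange_big.
  apply: eq_big_nat => i hi; rewrite exchange_big /=.
  rewrite big_nat_cond [RHS]big_nat_cond.
  apply: eq_bigr => j /andP[hj hij].
  have -> : G i j = \rsum_(0 <= k < J) (v q k j * v p k (i * j)%N).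
    rewrite /G -(minn_idPl (pJ (i * j)%N _)); last nia.
    rewrite minnAC -rsum_window.
    apply: eq_bigr => k _; rewrite /v.
    have -> : ((maxn (p (i * j)) (q j) <= k < minn (p (i * j) + H) (q j + H)) =
      ((q j <= k < q j + H) && (p (i * j) <= k < p (i * j) + H)))%N by lia.
    by do 2 case: (_ <= k < _)%N => /=; ring.
  by rewrite RtoC_rsum csum_mulr; apply: eq_bigr => k _; rewrite RtoC_mult; ring.
have bound : 2 * Cmod (\csum_(0 <= k < J) \csum_(1 <= n < N.+1)
    conv a (fun n => b n * RtoC (v q k n)) n * (d n * RtoC (v p k n)))%C <=
    Q * INR H * (nsq N b + nsq N d).
  apply: Rle_trans (Rmult_le_compat_l _ _ _ _ (Cmod_csum _ _ _)) _; first lra.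
  rewrite rsum_mulr.
  apply: Rle_trans (_ : \rsum_(0 <= k < J) (Q *
    (nsq N (fun n => b n * RtoC (v q k n))%C +
     nsq N (fun n => d n * RtoC (v p k n))%C)) <= _).
    apply: rsum_le => k _; apply: ha => n n1 nA.
    by rewrite (sb n n1 nA) Cmult_0_l.
  rewrite -rsum_mulr rsum_plus Rmult_assoc; apply: Rmult_le_compat_l => //.
  by have := vsum q b; have := vsum p d; lra.
rewrite GE in bound; move: bound; set S := (\csum_(_ <= _ < _) _)%C => bound.
have err : Cmod (RtoC (INR H) * T - S) <= K.
  have -> : (RtoC (INR H) * T - S = \csum_(1 <= i < N.+1)
      \csum_(1 <= j < N.+1 | (i * j <= N)%N) a i * b j * d (i * j)%N *
      RtoC (INR H * tent h c (ln (INR i)) - G i j))%C.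
    have -> : (RtoC (INR H) * T - S = RtoC (INR H) * T + - 1 * S)%C by ring.
    rewrite /T /S !csum_mulr -csum_plus; apply: eq_bigr => i _.
    rewrite !csum_mulr -csum_plus; apply: eq_bigr => j _.
    by rewrite RtoC_minus RtoC_mult; ring.
  apply: Rle_trans (Cmod_csum _ _ _) _; apply: rsum_nat_le => i hi.
  apply: Rle_trans (Cmod_csum _ _ _) _.
  rewrite big_nat_cond [X in _ <= X]big_nat_cond; apply: rsum_le => j /andP[hj hij].
  rewrite Cmod_mult Cmod_R.
  rewrite -[X in _ <= X]Rmult_1_r; apply: Rmult_le_compat_l; first exact: Cmod_ge_0.
  rewrite Rabs_minus_sym.
  have := window_overlap (hp (i * j)%N ltac:(nia)) (hq j ltac:(lia)) H0.
  rewrite /G /tent ln_mult_nat; try lia.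
  (* The offset between output [i * j] and input [j] depends on [i] alone; this is why a Schur
     multiplier of the matrix becomes a multiplier of the coefficients [a]. *)
  have -> : t * (ln (INR i) + ln (INR j)) - t * (ln (INR j) + c) =
    t * (ln (INR i) - c) by ring.
  rewrite Rabs_mult (Rabs_pos_eq t); last lra.
  have -> : t * Rabs (ln (INR i) - c) / INR H = Rabs (ln (INR i) - c) / h; last by [].
  by rewrite /t; field; lra.
have -> : INR H * Cmod T = Cmod (RtoC (INR H) * T).
  by rewrite Cmod_mult Cmod_R Rabs_pos_eq; lra.
have := Cmod_triangle (RtoC (INR H) * T - S) S.
have -> : (RtoC (INR H) * T - S + S = RtoC (INR H) * T)%C by ring.
lra.
Qed.

Definition trapezoid (h c x : R) : R := Rmin 1 (Rmax 0 (1 - (x - c) / h)).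

(** The de la Vallée Poussin combination; it costs a factor 2 + 1 = 3. *)
Lemma trapezoid_tents c x : 0 < c -> 0 <= x ->
  trapezoid c c x = 2 * tent (2 * c) 0 x - tent c 0 x.
Proof.
move=> c0 x0; rewrite /trapezoid /tent Rminus_0_r Rabs_pos_eq //.
have -> : (x - c) / c = x / c - 1 by field; lra.
have -> : x / (2 * c) = x / c / 2 by field; lra.
have : 0 <= x / c by apply: Rdiv_le_0_compat.
move: (x / c) => u u0.
rewrite /Rmax; do 3 case: Rle_dec => ?; rewrite /Rmin; case: Rle_dec => ?; lra.
Qed.

(** Halving the ramp removes half of one tent centred at its midpoint, so each halving costs only Q
    / 2 and steepness costs its logarithm. *)
Lemma trapezoid_half h c x : 0 < h ->
  trapezoid (h / 2) c x = trapezoid h c x - / 2 * tent (h / 2) (c + h / 2) x.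
Proof.
move=> h0; rewrite /trapezoid /tent; set u := (x - c) / (h / 2).
have -> : (x - c) / h = u / 2 by rewrite /u; field; lra.
have -> : Rabs (x - (c + h / 2)) / (h / 2) = Rabs (u - 1).
  rewrite -{2}(Rabs_pos_eq (h / 2)); last lra.
  by rewrite -Rabs_div; [congr Rabs; rewrite /u; field; lra | lra].
case: (Rcase_abs (u - 1)) => hu; [rewrite Rabs_left // | rewrite Rabs_right //];
  rewrite /Rmax; do 3 case: Rle_dec => ?; rewrite /Rmin;
  do !case: Rle_dec => ?; lra.
Qed.

Lemma form_bound_trapezoid A a Q c J : 0 <= Q -> 0 < c -> form_bound A a Q ->
  form_bound A (fun n => RtoC (trapezoid (c / 2 ^ J) c (ln (INR n))) * a n)%C
    ((3 + INR J / 2) * Q).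
Proof.
move=> Q0 c0 ha; elim: J => [|J IH].
  have c2 : 0 < 2 * c by lra.
  have h1 := form_bound_lin 2 (- (1))
    (form_bound_tent Q0 c2 (Rle_refl 0) ha)
    (form_bound_tent Q0 c0 (Rle_refl 0) ha).
  apply: (form_bound_le _ (form_bound_ext _ h1)).
    by rewrite Rabs_pos_eq ?Rabs_Ropp ?Rabs_R1 /=; lra.
  move=> n n1; rewrite /= Rdiv_1_r trapezoid_tents //; last exact: ln_ge0.
  by rewrite RtoC_minus RtoC_mult RtoC_opp; ring.
have hp : 0 < c / 2 ^ J by apply: Rdiv_lt_0_compat => //; apply: pow_lt; lra.
have hp2 : 0 < c / 2 ^ J / 2 by lra.
have hc : 0 <= c + c / 2 ^ J / 2 by lra.
have h1 := form_bound_lin 1 (- / 2) IH (form_bound_tent Q0 hp2 hc ha).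
apply: (form_bound_le _ (form_bound_ext _ h1)).
  by rewrite Rabs_R1 Rabs_Ropp Rabs_pos_eq ?S_INR; lra.
move=> n n1; have -> : c / 2 ^ J.+1 = c / 2 ^ J / 2.
  by rewrite /=; field; apply: pow_nonzero; lra.
by rewrite trapezoid_half // RtoC_minus RtoC_mult RtoC_opp; ring.
Qed.

(** * Bounded multipliers define bounded Dirichlet series *)

Lemma INR_expn (m k : nat) : INR (m ^ k)%N = INR m ^ k.
Proof. by elim: k => [|k IH] //; rewrite expnS mult_INR IH. Qed.

Lemma form_bound_partial A a Q N : 0 <= Q -> (2 <= N)%N -> form_bound A a Q ->
  form_bound A (fun n => if (n <= N)%N then a n else 0%C)
    ((4 + 2 * ln (INR N)) * Q).
Proof.
move=> Q0 N2 ha; pose K := (trunc_log 2 N).+1; pose c := ln (INR N).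
have c0 : 0 < c.
  by rewrite /c -ln_1; apply: ln_increasing; [lra | apply: (lt_INR 1); lia].
have N1 : (1 <= N)%N by lia.
have /andP[k1 k2] := trunc_log_bounds (isT : (1 < 2)%N) N1.
have hK : INR K <= 1 + 2 * c.
  have : INR (trunc_log 2 N) * ln 2 <= c.
    rewrite -ln_pow; last lra.
    apply: ln_le; first by apply: pow_lt; lra.
    by rewrite -(INR_expn 2); apply: le_INR; lia.
  by have := ln_lt_2; have := pos_INR (trunc_log 2 N); rewrite /K S_INR; nra.
have hN : INR N + 1 <= 2 ^ K.
  by rewrite -S_INR -(INR_expn 2); apply: le_INR; rewrite /K; lia.
(* The ramp must fit between log N and log(N + 1), a gap of at least 1 / (N + 1). As 2^K >= N + 1
   and log N <= N, [2 * K] halvings of the initial width log N suffice. They give the factor 3 + K,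
   and K <= 1 + 2 log N. *)
pose h := c / 2 ^ (2 * K); have p2 : 0 < 2 ^ K by apply: pow_lt; lra.
have p22 : 0 < 2 ^ (2 * K) by apply: pow_lt; lra.
have h0 : 0 < h by apply: Rdiv_lt_0_compat.
have hd : h <= ln (INR N.+1) - ln (INR N).
  apply: Rle_trans (ln_S_sub N1); rewrite S_INR.
  have Np := INR_pos N1; have cN : c <= INR N.
    by rewrite -(exp_ln _ Np); have := exp_ineq1_le (ln (INR N)); rewrite -/c; lra.
  apply/Rle_div_l => //; rewrite mulnC pow_mult.
  apply: Rle_trans cN _; apply/(Rmult_le_reg_l (INR N + 1)); first lra.
  rewrite -Rmult_assoc Rinv_r ?Rmult_1_l; last lra.
  have -> : (2 ^ K) ^ 2 = 2 ^ K * 2 ^ K by ring.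
  by nra.
have := form_bound_trapezoid (2 * K) Q0 c0 ha; rewrite -/h.
move/(@form_bound_ext _ _ (fun n => if (n <= N)%N then a n else 0%C)).
move=> h1; have {}h1 := h1 _ _; apply: (form_bound_le _ (h1 _)).
  apply: Rmult_le_compat_r => //; rewrite mult_INR (_ : INR 2 = 2) //.
  by rewrite -/c; lra.
move=> n n1; case: leqP => nN.
  suff -> : trapezoid h c (ln (INR n)) = 1 by rewrite Cmult_1_l.
  have : ln (INR n) <= c.
    by apply: ln_le; [apply: INR_pos | apply: le_INR; lia].
  move=> h2; have : 0 <= (c - ln (INR n)) / h by apply: Rdiv_le_0_compat => //; lra.
  have -> : (c - ln (INR n)) / h = - ((ln (INR n) - c) / h) by field; lra.
  move=> h3; rewrite /trapezoid Rmin_left // Rmax_right; lra.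
suff -> : trapezoid h c (ln (INR n)) = 0 by rewrite Cmult_0_l.
have : ln (INR N.+1) <= ln (INR n).
  by apply: ln_le; [apply: INR_pos | apply: le_INR; lia].
move=> h2; have : 1 <= (ln (INR n) - c) / h by apply/Rle_div_r => //; rewrite /c; lra.
by move=> h3; rewrite /trapezoid (Rmax_left 0) ?Rmin_right; lra.
Qed.

(** If x = 1 + y with y > 0, Bernoulli's inequality raised to the power N + 1 makes x^(k (N + 1)) at
    least (k y)^(N + 1), of degree N + 1 in k, against a bound of degree N. *)
Lemma pow_poly_le1 (x : R) (N : nat) : 0 <= x ->
  (forall k, x ^ k <= (INR k + 1) ^ N) -> x <= 1.
Proof.
move=> x0 h; apply: Rnot_lt_le => x1; pose y := x - 1.
have y0 : 0 < y by rewrite /y; lra.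
have Np := pos_INR N.
pose B := (INR N + 2) ^ N / y ^ N.+1; have yN : 0 < y ^ N.+1 by apply: pow_lt.
have B0 : 0 <= B by apply: Rdiv_le_0_compat => //; apply: pow_le; lra.
have [K HK] := nfloor_ex B B0; pose k := K.+1.
have kp : 0 < INR k by apply: INR_pos.
have k1 : 1 <= INR k by apply: INR_ge1.
have h1 : (INR k * y) ^ N.+1 <= x ^ (k * N.+1).
  rewrite pow_mult; apply: pow_incr; split; first by apply: Rmult_le_pos; lra.
  by have := poly k y y0; rewrite /y (_ : 1 + (x - 1) = x); [lra | ring].
have h2 : x ^ (k * N.+1) <= (INR k * (INR N + 2)) ^ N.
  apply: Rle_trans (h _) _; apply: pow_incr.
  by rewrite mult_INR S_INR; nra.
have : (INR k * y) ^ N.+1 <= (INR k * (INR N + 2)) ^ N by lra.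
rewrite !Rpow_mult_distr -tech_pow_Rmult.
have kN : 0 < INR k ^ N by apply: pow_lt.
have -> : INR k * INR k ^ N * y ^ N.+1 = INR k ^ N * (INR k * y ^ N.+1) by ring.
move/(Rmult_le_reg_l _ _ _ kN)/(Rle_div_r _ _ _ yN); rewrite -/B /k S_INR; lra.
Qed.

(** Products of powers of 1, ..., N with exponents at most [k]. All integers up to [N] serve as
    bases, prime or not: repetitions are harmless for an upper count, and the length (k + 1)^N is
    polynomial in [k]. *)
Fixpoint smooth_box (N k : nat) : seq nat :=
  if N is N'.+1 then
    [seq (N ^ v * m)%N | v <- iota 0 k.+1, m <- smooth_box N' k]
  else [:: 1%N].

Lemma size_smooth_box N k : size (smooth_box N k) = (k.+1 ^ N)%N.
Proof.
elim: N => [|N IH] //; rewrite expnS -IH -{1}(size_iota 0 k.+1).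
exact: size_allpairs.
Qed.

Lemma smooth_boxP N k n :
  reflect (exists vm, [/\ vm.1 \in iota 0 k.+1, vm.2 \in smooth_box N k &
    n = N.+1 ^ vm.1 * vm.2]%N) (n \in smooth_box N.+1 k).
Proof. exact: allpairsP. Qed.

Lemma smooth_box_incr N k : {subset smooth_box N k <= smooth_box N k.+1}.
Proof.
elim: N => [|N IH] n //; case/smooth_boxP=> -[v m] [].
rewrite mem_iota => hv /IH hm ->; apply/smooth_boxP; exists (v, m); split=> //.
by rewrite mem_iota; move: hv; rewrite /=; lia.
Qed.

Lemma smooth_box_mul N k j m : (1 <= j <= N)%N -> m \in smooth_box N k ->
  (j * m)%N \in smooth_box N k.+1.
Proof.
elim: N m => [|N IH] m hj; first lia.
case/smooth_boxP=> -[v m'] []; rewrite mem_iota => hv hm ->.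
case: (eqVneq j N.+1) => [->|jN]; apply/smooth_boxP.
  exists (v.+1, m'); split; last by rewrite expnS mulnA.
    by rewrite mem_iota; move: hv; rewrite /=; lia.
  exact: smooth_box_incr.
exists (v, (j * m')%N); split; last by rewrite mulnCA.
  by rewrite mem_iota; move: hv; rewrite /=; lia.
by apply: IH => //; lia.
Qed.

Lemma smooth_box1 N k : 1%N \in smooth_box N k.
Proof.
by elim: N => [|N IH] //; apply/smooth_boxP; exists (0%N, 1%N); split.
Qed.

(* The [k]-th convolution power of [e] lives on products of [k] integers
   [<= N]; there are only polynomially many of them in [k], so passing from
   the l2 bound [K ^ k] to an l1 bound costs a factor that disappears in the
   [k]-th root. *)
Lemma dirichlet_poly_bound A e K N s : unital_subsemigroup A ->
  supported_in A e -> 0 < K -> mult_bound A e K ->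
  (forall n, (N < n)%N -> e n = 0) -> 0 <= Re s ->
  Cmod (\csum_(1 <= n < N.+1) e n * npow n s) <= K.
Proof.
move=> uA se K0 hK eN s0; set E := (\csum_(_ <= _ < _) _)%C.
pose P k := iter k (conv e) unit_coef.
have sP k : supported_in A (P k).
  elim: k => [|k IH]; first exact: supported_unit.
  exact: supported_conv.
have nP k M : nsq M (P k) <= K ^ k * K ^ k.
  elim: k => [|k IH]; first by rewrite /=; have := nsq_unit M; lra.
  apply: Rle_trans (hK _ (sP k) M) _.
  have := Rmult_le_compat_l (K ^ 2) _ _ (pow2_ge_0 K) IH; rewrite /=; lra.
have bP k n : (1 <= n)%N -> n \notin smooth_box N k -> P k n = 0.
  elim: k n => [|k IH] n n1 hn.
    rewrite /P /= /unit_coef; case: eqP => // e1.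
    by rewrite e1 smooth_box1 in hn.
  rewrite /P /= -/(P k) /conv big_nat big1 // => i hi.
  rewrite big_nat_cond big1 // => j /andP[hj /eqP hij].
  case: (leqP i N) => iN; last by rewrite eN // Cmult_0_l.
  case hjb: (j \in smooth_box N k); last by rewrite IH ?hjb ?Cmult_0_r //; lia.
  by rewrite -hij (@smooth_box_mul N k i j) // in hn; lia.
have EP k : exists L, (1 <= L)%N /\ (forall n, (L < n)%N -> P k n = 0) /\
    (\csum_(1 <= n < L.+1) P k n * npow n s = E ^ k)%C.
  elim: k => [|k [L [L1 [hL eL]]]].
    exists 1%N; split=> //; split.
      by move=> n n1; rewrite /P /= /unit_coef; case: eqP => //; lia.
    by rewrite big_nat1 /P /= /unit_coef /= npow1n Cmult_1_l.
  exists (N.+1 * L)%N; split; first nia.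
  have prodP i j : (N.+1 * L < i * j)%N -> (e i * P k j = 0)%C.
    move=> hij; case: (leqP i N) => iN; last by rewrite eN // Cmult_0_l.
    by rewrite hL ?Cmult_0_r //; nia.
  split.
    move=> n hn; rewrite /P /= -/(P k) /conv big1 // => i _.
    by rewrite big1 // => j /eqP hij; apply: prodP; lia.
  rewrite /P /= -/(P k) sum_conv (@csum_shrink N); [|nia|]; last first.
    by move=> i iN; rewrite big1 // => j _; rewrite eN // !Cmult_0_l.
  rewrite -eL /E csum_mull; apply: eq_big_nat => i hi.
  rewrite csum_mulr big_mkcond (@csum_shrink L (N.+1 * L)); [|nia|]; last first.
    by move=> j jL; case: ifP => // _; rewrite hL // Cmult_0_r Cmult_0_l.
  apply: eq_big_nat => j hj; rewrite npow_mult; [|lia|lia].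
  case: leqP => hij; first ring.
  have -> : (e i * npow i s * (P k j * npow j s) =
    (e i * P k j) * (npow i s * npow j s))%C by ring.
  by rewrite prodP ?Cmult_0_l.
have main k : Cmod E ^ k <= K ^ k * (INR k + 1) ^ N.
  have [L [_ [_ eL]]] := EP k; have Kk : 0 < K ^ k by apply: pow_lt.
  rewrite -Cmod_pow -eL; apply: Rle_trans (Cmod_csum _ _ _) _.
  pose B := smooth_box N k.
  (* Cauchy-Schwarz as 2 x <= x^2 / K^k + K^k, the second term being charged only on the box outside
     which [P k] vanishes. *)
  apply: Rle_trans (_ : \rsum_(1 <= n < L.+1) (/ K ^ k / 2 * Cmod (P k n) ^ 2 +
     K ^ k / 2 * (if n \in B then 1 else 0)) <= _).
    apply: rsum_nat_le => n /andP[n1 _]; rewrite Cmod_mult Cmod_npow.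
    have r1 : rpow n (Re s) <= 1 by apply: rpow_le1.
    apply: Rle_trans (_ : Cmod (P k n) * 1 <= _).
      by apply: Rmult_le_compat_l; [apply: Cmod_ge_0 | lra].
    case hn: (n \in B); last first.
      by rewrite bP ?hn // Cmod_0 /=; lra.
    have := pow2_ge_0 (Cmod (P k n) - K ^ k).
    move/(Rmult_le_compat_l _ _ _ (Rlt_le _ _ (Rinv_0_lt_compat _ Kk))).
    have -> : / K ^ k * (Cmod (P k n) - K ^ k) ^ 2 =
      / K ^ k * Cmod (P k n) ^ 2 + K ^ k - 2 * Cmod (P k n) by field; lra.
    lra.
  rewrite rsum_plus -!rsum_mulr -/(nsq L (P k)).
  have h1 : \rsum_(1 <= n < L.+1) (if n \in B then 1 else 0) <= (INR k + 1) ^ N.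
    rewrite -S_INR -INR_expn -(size_smooth_box N k) -/B.
    have -> : \rsum_(1 <= n < L.+1) (if n \in B then 1 else 0) =
      INR (size [seq n <- index_iota 1 L.+1 | n \in B]).
      elim: (index_iota 1 L.+1) => [|n r IH]; first by rewrite big_nil.
      rewrite big_cons IH /=; case: ifP => _ /=; last by rewrite Rplus_0_l.
      by rewrite -/(INR _.+1) S_INR; lra.
    apply: le_INR; apply/leP; apply: uniq_leq_size.
      by apply: filter_uniq; apply: iota_uniq.
    by move=> n; rewrite mem_filter => /andP[].
  have h2 : / K ^ k / 2 * nsq L (P k) <= K ^ k / 2.
    have -> : K ^ k / 2 = / K ^ k / 2 * (K ^ k * K ^ k) by field; lra.
    apply: Rmult_le_compat_l (nP k L); have := Rinv_0_lt_compat _ Kk; lra.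
  have h3 : 1 <= (INR k + 1) ^ N.
    by apply: pow_R1_Rle; have := pos_INR k; lra.
  have h4 := Rmult_le_compat_l (K ^ k / 2) _ _ ltac:(lra) h1.
  have h5 := Rmult_le_compat_l (K ^ k) _ _ (Rlt_le _ _ Kk) h3.
  lra.
rewrite -[K]Rmult_1_l; apply/(Rle_div_l _ _ _ K0); apply: (@pow_poly_le1 _ N).
  by apply: Rdiv_le_0_compat => //; apply: Cmod_ge_0.
move=> k; rewrite /Rdiv Rpow_mult_distr pow_inv.
have Kk : 0 < K ^ k by apply: pow_lt.
have := main k; rewrite Rmult_comm => h; exact/(Rle_div_l _ _ _ Kk).
Qed.

Lemma mult_bound_convergence A a Q s : unital_subsemigroup A ->
  supported_in A a -> 0 < Q -> mult_bound A a Q -> 0 < Re s ->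
  exists l, Clim (fun N => \csum_(1 <= n < N.+1) a n * npow n s) l /\
    Cmod l <= Q.
Proof.
move=> uA sa Q0 ha s0; have fa := mult_form_bound Q0 ha.
have sup e K N z : supported_in A e -> 0 < K -> form_bound A e K ->
    (forall n, (N < n)%N -> e n = 0) -> 0 <= Re z ->
    Cmod (\csum_(1 <= n < N.+1) e n * npow n z) <= K.
  by move=> se K0 /(form_mult_bound K0); apply: dirichlet_poly_bound.
(* The imaginary part goes into the coefficients, so Abel summation is done at a real point. [D]
   comes from log N <= N^(x/2) / (x/2). *)
pose x := Re s; pose b n := (a n * npow n (0, Im s))%C.
pose D := (4 + 2 * / (x / 2)) * Q.
have ix : 0 < / (x / 2) by apply: Rinv_0_lt_compat; rewrite /x; lra.
have D0 : 0 < D by apply: Rmult_lt_0_compat; lra.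
have rp1 n : (1 <= n)%N -> 1 <= rpow n (- (x / 2)).
  move=> n1; rewrite /rpow -exp_0; apply: exp_le_compat.
  by have := ln_ge0 n1; rewrite Ropp_involutive /x; nra.
have S N : (1 <= N)%N ->
    Cmod (\csum_(1 <= n < N.+1) b n) <= D * rpow N (- (x / 2)).
  move=> N1; have r1 := rp1 N N1; case: (leqP 2 N) => N2.
    have e1 : (\csum_(1 <= n < N.+1) b n = \csum_(1 <= n < N.+1)
      (if (n <= N)%N then a n else 0) * npow n (0, Im s))%C.
      by apply: eq_big_nat => n /andP[_ nN]; rewrite ltnS in nN; rewrite nN.
    rewrite e1; have lN := ln_ge0 N1.
    apply: Rle_trans (sup _ ((4 + 2 * ln (INR N)) * Q) _ _ _ _ _ _ _) _.
    - by move=> n n1 nA; rewrite sa //; case: ifP.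
    - by apply: Rmult_lt_0_compat; lra.
    - by apply: form_bound_partial => //; lra.
    - by move=> n nN; case: leqP => //; lia.
    - by rewrite /=; lra.
    have h := @ln_le_rpow N (x / 2) ltac:(rewrite /x; lra).
    rewrite /D; have : 4 + 2 * ln (INR N) <=
      (4 + 2 * / (x / 2)) * rpow N (- (x / 2)) by nra.
    move/(Rmult_le_compat_r Q _ _ (Rlt_le _ _ Q0)); lra.
  (* The cut-off lemma starts at 2, because log N is its initial ramp width; a_1 is bounded by
     testing on the unit sequence. *)
  have -> : N = 1%N by lia.
  rewrite big_nat1 /b npow1n rpow1n Cmult_1_r Rmult_1_r.
  have := ha unit_coef (supported_unit uA) 1%N.
  rewrite {1}/nsq big_nat1 conv_unit //; have := nsq_unit 1 => h1 h2.
  apply: Rle_trans (_ : Q <= _); last by rewrite /D; nra.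
  apply: Rsqr_incr_0; [| exact: Cmod_ge_0 | lra].
  by rewrite !Rsqr_pow2; have := pow2_ge_0 Q; nra.
have bE n : (b n * npow n (RtoC x) = a n * npow n s)%C.
  by rewrite npow_real (npow_split n s) /b /x; ring.
have [l hl] : exists l, Clim (fun N => \csum_(1 <= n < N.+1) a n * npow n s) l.
  apply: Clim_cauchy => e e0.
  have [N [N1 HN]] := @rpow_lim0 (x / 2) (e / (2 * (2 * D)))
    ltac:(rewrite /x; lra) ltac:(by apply: Rdiv_lt_0_compat; lra).
  exists N => n m /andP[hn hm].
  rewrite (@big_cat_nat _ _ _ n.+1 1 m.+1) /=; try lia.
  set u := (\csum_(1 <= i < _) _)%C; set v := (\csum_(_ <= i < _) _)%C.
  have -> : (u + v - u = v)%C by ring.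
  have := @abel_bound b n.+1 (RtoC x) (2 * D) isT _ _ _ (m - n)%N.
  have -> : (n.+1 + (m - n) = m.+1)%N by lia.
  have -> : (\csum_(n.+1 <= i < m.+1) b i * npow i (RtoC x) = v)%C.
    by apply: eq_bigr => i _; rewrite bE.
  rewrite /= Rabs_R0 /Rdiv Rmult_0_l Rplus_0_r Rmult_1_r => h.
  apply: Rle_lt_trans (h _ _ _) _ => //; first by lra.
    move=> k; have h1 := S n ltac:(lia); have h2 := S (n.+1 + k)%N ltac:(lia).
    move: h2; rewrite (@big_cat_nat _ _ _ n.+1 1 (n.+1 + k).+1) /=; try lia.
    move: h1; set p := (\csum_(1 <= i < _) _)%C; set q := (\csum_(_ <= i < _) _)%C.
    move=> h1 h2; have -> : (q = (p + q) + - p)%C by ring.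
    apply: Rle_trans (Cmod_triangle _ _) _; rewrite Cmod_opp.
    have : rpow n (- (x / 2)) <= rpow (n.+1 + k) (- (x / 2)).
      rewrite /rpow; apply: exp_le_compat; rewrite Ropp_involutive.
      apply: Rmult_le_compat_l; first by rewrite /x; lra.
      by apply: ln_le; [apply: INR_pos; lia | apply: le_INR; lia].
    rewrite /Rdiv in h1 h2 *; nra.
  have D4 : 0 < 2 * (2 * D) by lra.
  have := HN n.+1 ltac:(lia); rewrite -/(Rdiv x 2).
  move/(Rlt_div_r _ _ _ D4); lra.
exists l; split=> //.
(* Riesz weights are values of a tent centred at 0, so the means keep the bound Q without loss and
   hand it to the limit. *)
apply: (Clim_Cmod_le (riesz_mean_Clim hl) (N0 := 2)) => N N2.
pose e n := (RtoC (tent (ln (INR N)) 0 (ln (INR n))) * a n)%C.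
have c0 : 0 < ln (INR N).
  by rewrite -ln_1; apply: ln_increasing; [lra | apply: (lt_INR 1); lia].
have -> : (\csum_(1 <= n < N.+1) RtoC (1 - ln (INR n) / ln (INR N)) *
  (a n * npow n s) = \csum_(1 <= n < N.+1) e n * npow n s)%C.
  apply: eq_big_nat => n /andP[n1 nN]; rewrite /e /tent Rminus_0_r.
  rewrite Rabs_pos_eq; last exact: ln_ge0.
  rewrite Rmax_right; first ring.
  have : ln (INR n) / ln (INR N) <= 1; last by lra.
  apply/Rle_div_l => //; rewrite Rmult_1_l.
  by apply: ln_le; [apply: INR_pos | apply: le_INR; lia].
apply: sup => //; last by lra.
- by move=> n n1 nA; rewrite /e sa // Cmult_0_r.
- by apply: form_bound_tent => //; lra.
move=> n nN; rewrite /e /tent Rminus_0_r.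
rewrite Rabs_pos_eq; last by apply: ln_ge0; lia.
rewrite Rmax_left ?Cmult_0_l //.
have : 1 <= ln (INR n) / ln (INR N); last by lra.
apply/Rle_div_r => //; rewrite Rmult_1_l.
by apply: ln_le; [apply: INR_pos; lia | apply: le_INR; lia].
Qed.

(** * Boundedness of multipliers *)

Lemma nsq_scal N (x : C) b :
  nsq N (fun n => x * b n)%C = Cmod x ^ 2 * nsq N b.
Proof.
rewrite /nsq rsum_mulr; apply: eq_bigr => n _.
by rewrite Cmod_mult Rpow_mult_distr.
Qed.

Lemma Cmod_parallelogram (z w : C) :
  Cmod (z + w) ^ 2 + Cmod (z + - w) ^ 2 = 2 * Cmod z ^ 2 + 2 * Cmod w ^ 2.
Proof. by rewrite !Cmod_sq /Re /Im /=; ring. Qed.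

Lemma nsq_parallelogram N b c :
  nsq N (fun n => b n + c n)%C + nsq N (fun n => b n + - c n)%C =
  2 * nsq N b + 2 * nsq N c.
Proof.
rewrite /nsq !rsum_mulr -!rsum_plus; apply: eq_bigr => n _.
exact: Cmod_parallelogram.
Qed.

Lemma nsq_plus_le N b c :
  nsq N (fun n => b n + c n)%C <= 2 * nsq N b + 2 * nsq N c.
Proof.
by rewrite -nsq_parallelogram; have := nsq_ge0 N (fun n => b n + - c n)%C; lra.
Qed.

Lemma nsq_stable (K N : nat) (b : nat -> C) : (K <= N)%N ->
  (forall n, (K < n)%N -> b n = 0) -> nsq N b = nsq K b.
Proof.
move=> KN h; rewrite /nsq (@big_cat_nat _ _ _ K.+1 1 N.+1) //=.
have -> : \rsum_(K.+1 <= i < N.+1) Cmod (b i) ^ 2 = 0; last by rewrite Rplus_0_r.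
by rewrite big_nat big1 // => i /andP[/h -> _]; rewrite Cmod_0 /=; ring.
Qed.

Lemma nsq_conv_ext N a b c : (forall n, (1 <= n <= N)%N -> b n = c n) ->
  nsq N (conv a b) = nsq N (conv a c).
Proof.
by move=> h; apply: nsq_ext => n hn; apply: conv_ext => m hm; apply: h; lia.
Qed.

Section UniformBoundedness.
Variables (A : nat -> Prop) (a : nat -> C).
Hypothesis conv_l2 : forall b, supported_in A b -> square_summable b ->
  square_summable (conv a b).

(** The hypothesis on each unit vector with index in [A] bounds the operator on finitely many
    coordinates; the dependence of [c] on [K] does no harm. *)
Lemma conv_low_bound K : exists c, 0 <= c /\ forall b, supported_in A b ->
  (forall n, (K < n)%N -> b n = 0) -> forall N, nsq N (conv a b) <= c * nsq K b.
Proof.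
elim: K => [|K [c [c0 IH]]].
  exists 0; split=> [|b _ b0 N]; first lra.
  rewrite /nsq big1 => [|n _]; first lra.
  have -> : conv a b n = 0; last by rewrite Cmod_0 /=; ring.
  rewrite /conv big1 // => i _; rewrite big_nat_cond big1 // => j /andP[hj _].
  by rewrite b0 ?Cmult_0_r //; lia.
case: (classic (A K.+1)) => AK; last first.
  exists c; split=> // b sb b0 N.
  have b0' n : (K < n)%N -> b n = 0.
    move=> Kn; case: (eqVneq n K.+1) => [->|nK]; first by apply: sb => //; lia.
    by apply: b0; lia.
  apply: Rle_trans (IH b sb b0' N) _; apply: Rmult_le_compat_l => //.
  exact: nsq_widen.
pose e n : C := if n == K.+1 then 1 else 0.
have se : supported_in A e.
  by move=> n _ nA; rewrite /e; case: eqP => // h; rewrite h in nA.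
have e2 : square_summable e.
  apply/square_summableP; exists (nsq K.+1 e) => N.
  apply: Rle_trans (nsq_widen e (leq_maxl N K.+1)) _.
  right; apply: nsq_stable; first exact: leq_maxr.
  by move=> n Kn; rewrite /e; case: eqP => //; lia.
have /square_summableP[B HB] := conv_l2 se e2.
have B0 : 0 <= B := Rle_trans _ _ _ (nsq_ge0 0 _) (HB 0%N).
exists (2 * c + 2 * B); split=> [|b sb b0 N]; first lra.
pose b' n : C := if (n <= K)%N then b n else 0.
have e1 : nsq N (conv a b) =
    nsq N (fun n => conv a b' n + b K.+1 * conv a e n)%C.
  apply: nsq_ext => n _; rewrite -conv_scal -conv_plus.
  apply: conv_ext => m hm; rewrite /b' /e; case: (ltngtP m K.+1) => h.
  - by rewrite -ltnS h; ring.
  - by rewrite b0 // leqNgt (ltnW h) /=; ring.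
  - by rewrite h ltnn; ring.
rewrite e1; apply: Rle_trans (nsq_plus_le _ _ _) _; rewrite nsq_scal.
have h1 : nsq N (conv a b') <= c * nsq K b'.
  apply: IH => [n n1 nA|n Kn]; first by rewrite /b' sb //; case: ifP.
  by rewrite /b' leqNgt Kn.
have h2 : nsq K b' <= nsq K.+1 b.
  rewrite (@nsq_ext K b' b); first exact: nsq_widen.
  by move=> n /andP[_ nK]; rewrite /b' nK.
have h3 : Cmod (b K.+1) ^ 2 <= nsq K.+1 b.
  by rewrite /nsq rsum_recr; have := nsq_ge0 K b; rewrite /nsq; lra.
have h4 := Rmult_le_compat_l _ _ _ c0 h2.
have h5 := HB N; have h6 := nsq_ge0 N (conv a e); have h7 := pow2_ge_0 (Cmod (b K.+1)).
have : Cmod (b K.+1) ^ 2 * nsq N (conv a e) <= nsq K.+1 b * B.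
  by apply: Rmult_le_compat.
lra.
Qed.

Hypothesis unbounded : forall Q, 0 < Q -> ~ mult_bound A a Q.

(** A vector violating a large enough bound still violates one after its first K coordinates are
    removed, since these are controlled by [conv_low_bound]. *)
Lemma hump K eps M : 0 < eps -> 0 < M -> exists b N, supported_in A b /\
  (forall n, (n <= K)%N -> b n = 0) /\ (forall n, (N < n)%N -> b n = 0) /\
  nsq N b <= eps /\ M <= nsq N (conv a b).
Proof.
move=> e0 M0; have [c [c0 hc]] := conv_low_bound K.
have Me : 0 < M / eps by apply: Rdiv_lt_0_compat.
(* [2 * c] absorbs the removed coordinates; the rest makes the output of [hi] exceed M / eps times
   the input. The 2s come from [nsq_plus_le]. *)
pose Q := sqrt (2 * c + 2 * (M / eps)).
have Q2 : Q ^ 2 = 2 * c + 2 * (M / eps) by apply: pow2_sqrt; lra.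
have Q0 : 0 < Q by apply: sqrt_lt_R0; lra.
have [b [N [sb hb]]] : exists b N, supported_in A b /\
    Q ^ 2 * nsq N b < nsq N (conv a b).
  apply: NNPP => h; apply: (unbounded Q0) => b sb N.
  by apply: Rnot_lt_le => hb; apply: h; exists b, N.
rewrite Q2 in hb.
pose lo n : C := if (n <= N)%N && (n <= K)%N then b n else 0.
pose hi n : C := if (n <= N)%N && ~~ (n <= K)%N then b n else 0.
have lob : nsq K lo <= nsq N b.
  apply: Rle_trans (nsq_widen lo (leq_maxl K N)) _.
  rewrite (@nsq_stable N (maxn K N) lo) ?leq_maxr //; last first.
    by move=> n Nn; rewrite /lo leqNgt Nn.
  apply: rsum_le => n _; rewrite /lo; case: ifP => _; first lra.
  by rewrite Cmod_0 /=; have := pow2_ge_0 (Cmod (b n)); rewrite /=; lra.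
have hib : nsq N hi <= nsq N b.
  apply: rsum_le => n _; rewrite /hi; case: ifP => _; first lra.
  by rewrite Cmod_0 /=; have := pow2_ge_0 (Cmod (b n)); rewrite /=; lra.
have slo : supported_in A lo by move=> n n1 nA; rewrite /lo sb //; case: ifP.
have shi : supported_in A hi by move=> n n1 nA; rewrite /hi sb //; case: ifP.
have hlo := hc lo slo _ N.
have {}hlo : nsq N (conv a lo) <= c * nsq K lo.
  by apply: hlo => n Kn; rewrite /lo [(n <= K)%N]leqNgt Kn andbF.
have split_b : nsq N (conv a b) <= 2 * nsq N (conv a lo) + 2 * nsq N (conv a hi).
  apply: Rle_trans (nsq_plus_le _ _ _); right; apply: nsq_ext => n hn.
  rewrite -conv_plus; apply: conv_ext => m hm; rewrite /lo /hi.
  have -> : (m <= N)%N by lia.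
  by case: (m <= K)%N => /=; ring.
set X := nsq N (conv a hi) in split_b; set beta := nsq N b in hb lob hib.
have beta0 : 0 <= beta := nsq_ge0 _ _.
have hX : M / eps * beta < X.
  by have := Rmult_le_compat_l _ _ _ c0 lob; lra.
have X0 : 0 < X by apply: Rle_lt_trans hX; apply: Rmult_le_pos => //; lra.
(* Rescales the output up to [N] to exactly [M], which forces the input below [eps]. *)
pose r := sqrt (M / X).
have r2 : Cmod (RtoC r) ^ 2 = M / X.
  rewrite Cmod_R pow2_abs; apply: pow2_sqrt.
  by apply: Rlt_le; apply: Rdiv_lt_0_compat.
exists (fun n => RtoC r * hi n)%C, N; split.
  by move=> n n1 nA; rewrite shi // Cmult_0_r.
split; first by move=> n nK; rewrite /hi nK andbF Cmult_0_r.
split; first by move=> n Nn; rewrite /hi leqNgt Nn Cmult_0_r.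
split; rewrite ?nsq_scal ?r2.
  apply: Rle_trans (_ : M / X * beta <= _).
    by apply: Rmult_le_compat_l => //; apply: Rlt_le; apply: Rdiv_lt_0_compat.
  have -> : M / X * beta = eps * (M / eps * beta) / X by field; lra.
  by apply/(Rle_div_l _ _ _ X0); apply: Rmult_le_compat_l; lra.
rewrite (@nsq_ext N _ (fun n => RtoC r * conv a hi n)%C); last first.
  by move=> n _; rewrite conv_scal.
by rewrite nsq_scal r2 -/X; right; field; lra.
Qed.

Definition hump_state := {p : (nat -> C) * nat |
  supported_in A p.1 /\ forall n, (p.2 < n)%N -> p.1 n = 0}.

(** The increments of the squared norm are summable while the outputs tend to infinity. Outputs are
    measured only up to the cut-off of [q], where later steps change nothing. *)
Definition hump_step (k : nat) (p q : hump_state) : Prop :=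
  ((sval p).2 < (sval q).2)%N /\
  (forall n, (n <= (sval p).2)%N -> (sval q).1 n = (sval p).1 n) /\
  nsq (sval q).2 (sval q).1 <= nsq (sval p).2 (sval p).1 + (/ 2) ^ k /\
  INR k <= nsq (sval q).2 (conv a (sval q).1).

Lemma hump_step_ex k p : exists q, hump_step k p q.
Proof.
case: p => -[x K] [/= sx x0].
have e0 : 0 < (/ 2) ^ k by apply: pow_lt; lra.
have M0 : 0 < INR k + 1 by have := pos_INR k; lra.
have [b [N [sb [bK [bN [nb nab]]]]]] := @hump K _ _ e0 M0.
(* By the parallelogram law one of x + b and x - b has an output at least as large as that of [b]
   alone, so earlier humps cannot cancel the new one. *)
have [sgn [hs hsgn]] : exists sgn : C, Cmod sgn = 1 /\
    INR k <= nsq N (conv a (fun n => x n + sgn * b n)%C).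
  have e1 y : nsq N (conv a (fun n => x n + y * b n)%C) =
      nsq N (fun n => conv a x n + y * conv a b n)%C.
    by apply: nsq_ext => n _; rewrite conv_plus conv_scal.
  have := nsq_parallelogram N (conv a x) (conv a b).
  have := nsq_ge0 N (conv a x) => h1 h2.
  case: (Rle_lt_dec (INR k) (nsq N (fun n => conv a x n + conv a b n)%C)) => h3.
    exists (RtoC 1); split; first exact: Cmod_1.
    rewrite e1; apply: Rle_trans h3 _; right; apply: nsq_ext => n _.
    by rewrite Cmult_1_l.
  exists (- RtoC 1)%C; split; first by rewrite Cmod_opp Cmod_1.
  rewrite e1; apply: Rle_trans (_ : nsq N (fun n => conv a x n + - conv a b n)%C <= _).
    by lra.
  by right; apply: nsq_ext => n _; congr (_ + _)%C; ring.
(* The successor makes the cut-offs strictly increase, hence [K k] is at least k. *)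
pose K' := (maxn N K).+1.
pose x' n := (x n + sgn * b n)%C.
have hq : supported_in A x' /\ forall n, (K' < n)%N -> x' n = 0.
  split=> n.
    by move=> n1 nA; rewrite /x' sx // sb //; ring.
  by rewrite /K' => h; rewrite /x' x0 ?bN //; [ring | lia | lia].
exists (exist _ (x', K') hq); split=> /=; first by rewrite /K'; lia.
split; first by move=> n nK; rewrite /x' bK // Cmult_0_r Cplus_0_r.
split; last by apply: Rle_trans hsgn _; apply: nsq_widen; rewrite /K'; lia.
have -> : nsq K' x' = nsq K' x + nsq K' b.
  rewrite /nsq -rsum_plus; apply: eq_bigr => n _; rewrite /x'.
  case: (leqP n K) => nK.
    by rewrite bK // Cmult_0_r Cplus_0_r Cmod_0 /=; ring.
  by rewrite x0 // Cplus_0_l Cmod_mult hs Cmod_0 /=; ring.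
rewrite (@nsq_stable K K' x) ?(@nsq_stable N K' b) //; try by rewrite /K'; lia.
by lra.
Qed.

Lemma unbounded_absurd : False.
Proof.
have init : supported_in A (fun=> RtoC 0) /\ forall n, (0 < n)%N -> RtoC 0 = 0 by [].
pose step k p := proj1_sig (constructive_indefinite_description _ (hump_step_ex k p)).
pose F := nat_rect (fun=> hump_state) (exist _ ((fun=> RtoC 0), 0%N) init) step.
have FS k : hump_step k (F k) (F k.+1).
  exact: (proj2_sig (constructive_indefinite_description _ (hump_step_ex k (F k)))).
pose x k := (sval (F k)).1; pose K k := (sval (F k)).2.
have Kincr k m : (k <= m)%N -> (K k <= K m)%N.
  move/subnKC <-; elim: (m - k)%N => [|d IH]; first by rewrite addn0.
  by rewrite addnS; have [h _] := FS (k + d)%N; apply: leq_trans IH (ltnW h).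
have Kge k : (k <= K k)%N.
  by elim: k => [|k IH] //; have [h _] := FS k; apply: leq_ltn_trans IH h.
have stab k m n : (k <= m)%N -> (n <= K k)%N -> x m n = x k n.
  move/subnKC <- => nK; elim: (m - k)%N => [|d IH]; first by rewrite addn0.
  rewrite addnS -IH; have [_ [h _]] := FS (k + d)%N; apply: h.
  by apply: leq_trans nK (Kincr _ _ _); apply: leq_addr.
(* The limit of the states: since n <= [K n], coordinate n is frozen from stage n on. *)
pose y n := x n n.
have yx k n : (n <= K k)%N -> y n = x k n.
  move=> nK; case/orP: (leq_total n k) => h; last exact: stab.
  by rewrite /y -(stab n k n h (Kge n)).
have sy : supported_in A y.
  by move=> n; have [h _] := proj2_sig (F n); apply: h.
have nx k : nsq (K k) (x k) <= 2 - 2 * (/ 2) ^ k.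
  elim: k => [|k IH]; first by rewrite /nsq /K /= big_geq //; lra.
  have [_ [_ [h _]]] := FS k; rewrite -/(K k.+1) -/(x k.+1) -/(K k) -/(x k) in h.
  by rewrite /= in h *; lra.
have y2 : square_summable y.
  apply/square_summableP; exists 2 => N.
  apply: Rle_trans (nsq_widen y (Kge N)) _.
  rewrite (@nsq_ext _ y (x N)) => [|n /andP[_ nK]]; last exact: yx.
  have hN : 0 < (/ 2) ^ N by apply: pow_lt; lra.
  by have := nx N; lra.
have /square_summableP[B HB] := conv_l2 sy y2.
have B0 : 0 <= B := Rle_trans _ _ _ (nsq_ge0 0 _) (HB 0%N).
have [k hk] := nfloor_ex B B0.
have [_ [_ [_ h]]] := FS k.+1; rewrite -/(K k.+2) -/(x k.+2) in h.
have := HB (K k.+2); rewrite (@nsq_conv_ext _ a y (x k.+2)).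
  by rewrite S_INR in h; lra.
by move=> n /andP[_ nK]; apply: yx.
Qed.

End UniformBoundedness.

Lemma mult_bound_ex A a :
  (forall b, supported_in A b -> square_summable b ->
     square_summable (conv a b)) -> exists Q, 0 < Q /\ mult_bound A a Q.
Proof.
move=> h; apply: NNPP => nQ; apply: (@unbounded_absurd A a h) => Q Q0 hQ.
by apply: nQ; exists Q.
Qed.

(** * Mean values on vertical lines *)

Definition expi (x : R) : C := Cexp (0, x).

Lemma expi_plus x y : expi (x + y) = (expi x * expi y)%C.
Proof.
by rewrite /expi -Cexp_plus; congr Cexp; rewrite /Cplus /=; congr pair; ring.
Qed.

Lemma expi0 : expi 0 = 1.
Proof. exact: Cexp_0. Qed.

Lemma Cmod_expi u : Cmod (expi u) = 1.
Proof. by rewrite /expi Cmod_Cexp /= exp_0. Qed.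

(** Averages over a progression stand in for integrals over an interval of length L d, so that
    linearity and positivity are those of finite sums. *)
Definition mean1 (L : nat) (d : R) (h : R -> C) (t : R) : C :=
  (RtoC (/ INR L) * \csum_(0 <= j < L) h (t + INR j * d)%R)%C.

Definition mean (k L : nat) (d : R) (h : R -> C) : R -> C :=
  iter k (mean1 L d) h.

Section Mean.
Variables (L : nat) (d : R).
Hypotheses (L1 : (1 <= L)%N) (d0 : 0 < d).

Lemma mean_ext k f g : (forall t, f t = g t) ->
  forall t, mean k L d f t = mean k L d g t.
Proof.
move=> h; elim: k => [|k IH] t //=.
by rewrite /mean1; congr (_ * _)%C; apply: eq_bigr => j _; apply: IH.
Qed.

Lemma mean_plus k f g t :
  mean k L d (fun t => f t + g t)%C t = (mean k L d f t + mean k L d g t)%C.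
Proof.
elim: k t => [|k IH] t //; rewrite /mean !iterS /mean1 -Cmult_plus_distr_l.
rewrite -csum_plus; congr (_ * _)%C; apply: eq_bigr => j _; exact: IH.
Qed.

Lemma mean_scal k x f t :
  mean k L d (fun t => x * f t)%C t = (x * mean k L d f t)%C.
Proof.
elim: k t => [|k IH] t //; rewrite /mean !iterS /mean1.
rewrite [RHS]Cmult_assoc (Cmult_comm x) -[RHS]Cmult_assoc [in RHS]csum_mulr.
by congr (_ * _)%C; apply: eq_bigr => j _; apply: IH.
Qed.

Lemma mean_csum k (I : Type) (r : seq I) (f : I -> R -> C) t :
  mean k L d (fun t => \csum_(i <- r) f i t) t =
  (\csum_(i <- r) mean k L d (f i) t)%C.
Proof.
elim: r => [|i r IH].
  rewrite big_nil -[RHS](Cmult_0_l (mean k L d (fun=> RtoC 0) t)) -mean_scal.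
  by apply: mean_ext => u; rewrite big_nil; ring.
rewrite big_cons -IH -mean_plus; apply: mean_ext => u; exact: big_cons.
Qed.

Lemma mean_Re_ge0 k f : (forall t, 0 <= Re (f t)) ->
  forall t, 0 <= Re (mean k L d f t).
Proof.
move=> h; elim: k => [|k IH] t //.
rewrite /mean iterS /mean1 -/(mean k L d f).
set S := (\csum_(_ <= _ < _) _)%C.
have -> : Re (RtoC (/ INR L) * S) = / INR L * Re S by rewrite /Re /=; ring.
apply: Rmult_le_pos; first by apply: Rlt_le; apply: Rinv_0_lt_compat; apply: INR_pos.
by rewrite /S Re_csum; apply: rsum_ge0 => j _; apply: IH.
Qed.

Lemma mean_bound k f B t :
  (forall u, t <= u <= t + INR k * (INR L * d) -> Cmod (f u) <= B) ->
  Cmod (mean k L d f t) <= B.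
Proof.
elim: k t => [|k IH] t h.
  by apply: h; rewrite /= Rmult_0_l Rplus_0_r; lra.
have Lp := INR_pos L1.
rewrite /mean iterS /mean1 -/(mean k L d f) Cmod_mult Cmod_R Rabs_pos_eq; last first.
  by apply: Rlt_le; apply: Rinv_0_lt_compat.
apply: Rle_trans (_ : / INR L * (\rsum_(0 <= j < L) B) <= _).
  apply: Rmult_le_compat_l; first by apply: Rlt_le; apply: Rinv_0_lt_compat.
  apply: Rle_trans (Cmod_csum _ _ _) _; apply: rsum_nat_le => j /andP[_ jL].
  apply: IH => u [u1 u2]; apply: h; rewrite S_INR.
  have jp := pos_INR j; have jL' := le_INR j L ltac:(lia).
  have h1 : 0 <= INR j * d by apply: Rmult_le_pos; lra.
  have h2 : INR j * d <= INR L * d by apply: Rmult_le_compat_r; lra.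
  by lra.
by rewrite rsum_nat_const subn0 -Rmult_assoc Rinv_l; lra.
Qed.

Lemma mean_const k x t : mean k L d (fun=> x) t = x.
Proof.
have Lp := INR_pos L1.
elim: k t => [|k IH] t //; rewrite /mean iterS /mean1 -/(mean k L d (fun=> x)).
rewrite (eq_bigr (fun=> (RtoC 1 * x)%C)); last by move=> j _; rewrite IH Cmult_1_l.
rewrite -csum_mull -RtoC_rsum rsum_nat_const subn0 Cmult_assoc -RtoC_mult.
have -> : / INR L * (INR L * 1) = 1 by field; lra.
by rewrite Cmult_1_l.
Qed.

(** A character is an eigenfunction of [mean1], so iterating the mean raises its damping factor to
    the k-th power. *)
Lemma mean_char k l t : mean k L d (fun t => expi (l * t)) t =
  ((RtoC (/ INR L) * \csum_(0 <= j < L) expi (l * (INR j * d))) ^ k *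
   expi (l * t))%C.
Proof.
elim: k t => [|k IH] t; first by rewrite /= Cmult_1_l.
rewrite /mean iterS /mean1 -/(mean k L d _) /=.
set D := (RtoC _ * _)%C in IH *.
rewrite (eq_bigr (fun j => expi (l * (INR j * d)) * (D ^ k * expi (l * t)))%C).
  by rewrite -csum_mull /D; ring.
move=> j _; rewrite IH.
have -> : l * (t + INR j * d) = l * (INR j * d) + l * t by ring.
by rewrite expi_plus; ring.
Qed.

Lemma sin_ge_half x : 0 <= x <= 1 -> x / 2 <= sin x.
Proof.
move=> [x0 x1]; have := PI2_1; rewrite /PI2 => pi1.
have [h _] := SIN x x0 ltac:(lra).
apply: Rle_trans h; rewrite /sin_lb /sin_approx /sum_f_R0 /sin_term.
rewrite !INR_IZR_INZ; simpl Z.of_nat.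
have -> : x ^ 3 = x * x ^ 2 by ring.
have -> : x ^ 5 = x * (x ^ 2) ^ 2 by ring.
have -> : x ^ 7 = x * (x ^ 2) ^ 3 by ring.
have x2 : 0 <= x ^ 2 <= 1 by rewrite /=; nra.
move: x2; set z := x ^ 2 => x2.
have h1 : 0 <= z ^ 2 - z ^ 3 <= 1 by rewrite /=; nra.
have h2 : 0 <= z ^ 2 <= 1 by rewrite /=; nra.
by rewrite /=; nra.
Qed.

(** Geometric sum: its modulus times |1 - e^(i l d)| is at most 2. The condition on [d] excludes
    aliasing: it keeps the angle in the range where the sine is at least half of it. *)
Lemma mean_char_bound k l t : l <> 0 -> Rabs l * d <= 1 ->
  Cmod (mean k L d (fun t => expi (l * t)) t) <=
  (4 / (INR L * d * Rabs l)) ^ k.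
Proof.
move=> l0 ld; rewrite mean_char Cmod_mult Cmod_expi Rmult_1_r Cmod_pow.
have Lp := INR_pos L1; have lp := Rabs_pos_lt l l0.
apply: pow_incr; split; first exact: Cmod_ge_0.
set S := (\csum_(_ <= _ < _) _)%C.
have tele m : ((\csum_(0 <= j < m) expi (l * (INR j * d))) *
    (1 - expi (l * d)) = 1 - expi (l * (INR m * d)))%C.
  elim: m => [|m IH].
    rewrite big_geq // Cmult_0_l /= Rmult_0_l Rmult_0_r.
    by rewrite expi0; ring.
  rewrite big_nat_recr //= Cmult_plus_distr_r IH -/(INR m.+1) S_INR.
  have -> : l * ((INR m + 1) * d) = l * (INR m * d) + l * d by ring.
  by rewrite expi_plus; ring.
have h1 : Cmod S * Cmod (1 - expi (l * d)) <= 2.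
  rewrite -Cmod_mult /S tele; apply: Rle_trans (Cmod_triangle _ _) _.
  by rewrite Cmod_opp Cmod_expi Cmod_1; lra.
have h2 : Rabs l * d / 2 <= Cmod (1 - expi (l * d)).
  apply: Rle_trans (Im_le_Cmod _).
  rewrite /expi /Cexp /Im /= exp_0.
  have -> : 0 + - (1 * sin (l * d) + 0 * cos (l * d)) = - sin (l * d) by ring.
  rewrite Rabs_Ropp; have ld0 : 0 <= Rabs l * d by apply: Rmult_le_pos; lra.
  apply: Rle_trans (sin_ge_half (conj ld0 ld)) _.
  case: (Rle_lt_dec 0 l) => hl.
    by rewrite (Rabs_pos_eq l) //; apply: Rle_abs.
  rewrite (Rabs_left l) //.
  have -> : - l * d = - (l * d) by ring.
  by rewrite sin_neg -Rabs_Ropp; apply: Rle_abs.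
rewrite Cmod_mult Cmod_R Rabs_pos_eq; last by apply: Rlt_le; apply: Rinv_0_lt_compat.
have ld0 : 0 < Rabs l * d by apply: Rmult_lt_0_compat.
have h3 : Cmod S * (Rabs l * d / 2) <= 2.
  by apply: Rle_trans h1; apply: Rmult_le_compat_l => //; apply: Cmod_ge_0.
have -> : 4 / (INR L * d * Rabs l) = / INR L * (4 / (Rabs l * d)).
  by field; repeat split; lra.
apply: Rmult_le_compat_l; first by apply: Rlt_le; apply: Rinv_0_lt_compat.
apply/Rle_div_r; lra.
Qed.

End Mean.

Lemma Clim_rate (u : nat -> C) (l : C) (B : R) (N0 : nat) :
  (forall n, (N0 <= n)%N -> Cmod (u n - l) <= B / INR n.+1) -> Clim u l.
Proof.
move=> h e e0; have [K HK] := nfloor_ex (Rabs B / e)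
  ltac:(by apply: Rdiv_le_0_compat (Rabs_pos _) _).
exists (maxn N0 K) => n; rewrite geq_max => /andP[/h h1 hK].
apply: Rle_lt_trans h1 _; have np : 0 < INR n.+1 by apply: INR_pos.
apply/(Rlt_div_l _ _ _ np); apply: Rle_lt_trans (Rle_abs _) _.
rewrite Rmult_comm; apply/(Rlt_div_l _ _ _ e0).
by have := le_INR K n ltac:(lia); rewrite S_INR; lra.
Qed.

Lemma Clim_bounded (u : nat -> C) (l : C) :
  Clim u l -> exists B, forall n, Cmod (u n) <= B.
Proof.
move=> hl; have [N HN] := hl 1 Rlt_0_1.
have s0 M : 0 <= \rsum_(0 <= n < M) Cmod (u n).
  by apply: rsum_nat_ge0 => i _; apply: Cmod_ge_0.
exists (1 + Cmod l + \rsum_(0 <= n < N) Cmod (u n)) => n.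
case: (leqP N n) => nN.
  have := HN n nN; have := Cmod_triangle (u n - l) l.
  have -> : (u n - l + l = u n)%C by ring.
  by have := s0 N; lra.
rewrite (@big_cat_nat _ _ _ n.+1 0 N) //= big_nat_recr //=.
have := s0 n; have := Cmod_ge_0 l.
have : 0 <= \rsum_(n.+1 <= i < N) Cmod (u i).
  by apply: rsum_nat_ge0 => i _; apply: Cmod_ge_0.
lra.
Qed.

(* Averaging over [k = p + 1] nested arithmetic progressions of total length
   about [Y = y + 1]. Characters at distance [c] from 0 are damped by
   [(4 / (c Y)) ^ (p + 1)], which beats the number [Y ^ p] of terms that are
   kept; the step [1 / Y ^ (2 p)] is so small that no frequency is aliased. *)
Definition avg (p y : nat) (h : R -> C) : C :=
  mean p.+1 (y.+1 * (y.+1 ^ p * y.+1 ^ p)) (/ INR (y.+1 ^ p * y.+1 ^ p)) h 0.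

Section DirichletTail.
Variables (a : nat -> C) (F : C -> C).
Hypothesis aF : forall s, 0 < Re s ->
  Clim (fun N => \csum_(1 <= n < N.+1) a n * npow n s)%C (F s).

(** Convergence at sigma / 2 bounds the partial sums there; Abel summation against the other sigma /
    2 + i t keeps half of it as a rate, hence sigma / 4. *)
Lemma dirichlet_tail sigma : 0 < sigma -> exists D, 0 <= D /\
  forall X t, (1 <= X)%N -> 0 <= t ->
  Cmod (F (sigma, t) - \csum_(1 <= n < X.+1) a n * npow n (sigma, t)) <=
  D * (1 + t) * rpow X (sigma / 4).
Proof.
move=> s0; have s2 : 0 < Re (RtoC (sigma / 2)) by rewrite /=; lra.
have [B HB] := Clim_bounded (aF s2).
have B0 : 0 <= B := Rle_trans _ _ _ (Cmod_ge_0 _) (HB 0%N).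
have is0 : 0 < / sigma by apply: Rinv_0_lt_compat.
exists (2 * (2 * B) * (1 + 2 / sigma)); split.
  by apply: Rmult_le_pos; rewrite /Rdiv; lra.
move=> X t X1 t0; pose s : C := (sigma / 2, t).
pose b n := (a n * npow n (RtoC (sigma / 2)))%C.
have bE n : (b n * npow n s = a n * npow n (sigma, t))%C.
  rewrite /b -Cmult_assoc -npow_plus; congr (_ * npow _ _)%C.
  by rewrite /s /Cplus /=; congr pair; lra.
have hs : 0 < Re s by rewrite /s /=; lra.
have rp1 n : (1 <= n)%N -> 1 <= rpow n (- (Re s / 2)).
  move=> n1; rewrite /rpow -exp_0; apply: exp_le_compat.
  by have := ln_ge0 n1; rewrite Ropp_involutive; nra.
have key := @abel_bound b X.+1 s (2 * B) isT hs ltac:(lra).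
have {}key m : Cmod (\csum_(X.+1 <= i < X.+1 + m) b i * npow i s) <=
    2 * (2 * B) * (1 + Rabs (Im s) / Re s) * rpow X.+1 (Re s / 2).
  apply: key => j; have := HB X; have := HB (X.+1 + j)%N.
  rewrite (@big_cat_nat _ _ _ X.+1 1 (X.+1 + j).+1) /=; try lia.
  set u := (\csum_(1 <= i < _) _)%C; set v := (\csum_(_ <= i < _) _)%C => h1 h2.
  have -> : (v = (u + v) + - u)%C by ring.
  apply: Rle_trans (Cmod_triangle _ _) _; rewrite Cmod_opp.
  have B2 : 0 <= 2 * B by lra.
  have := Rmult_le_compat_l _ _ _ B2 (rp1 (X.+1 + j)%N isT).
  by change (Re s) with (sigma / 2); lra.
have L := Clim_plus (aF (s0 : 0 < Re (sigma, t)))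
  (Clim_const (- \csum_(1 <= n < X.+1) a n * npow n (sigma, t))%C).
apply: Rle_trans (Clim_Cmod_le L (N0 := X) _) _.
  move=> n Xn; rewrite (@big_cat_nat _ _ _ X.+1 1 n.+1) /=; try lia.
  set u := (\csum_(1 <= i < _) _)%C; set v := (\csum_(_ <= i < _) _)%C.
  have -> : (u + v + - u = v)%C by ring.
  have -> : (v = \csum_(X.+1 <= i < X.+1 + (n - X)) b i * npow i s)%C.
    have -> : (X.+1 + (n - X) = n.+1)%N by lia.
    by apply: eq_bigr => i _; rewrite bE.
  exact: key.
rewrite /s /Im /Re /= (Rabs_pos_eq t) //.
have -> : sigma / 2 / 2 = sigma / 4 by field.
have r1 : rpow X.+1 (sigma / 4) <= rpow X (sigma / 4).
  by apply: rpow_decr => //; lra.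
have r0 := rpow_pos X.+1 (sigma / 4).
apply: Rmult_le_compat => //; last 2 first.
- lra.
- have -> : t / (sigma / 2) = 2 / sigma * t by field; lra.
  have : 0 <= 2 / sigma * t by apply: Rmult_le_pos => //; rewrite /Rdiv; lra.
  have : 0 <= 2 / sigma by rewrite /Rdiv; lra.
  move=> h1 h2; have B4 : 0 <= 2 * (2 * B) by lra.
  have h3 : 1 + 2 / sigma * t <= (1 + 2 / sigma) * (1 + t) by nra.
  by have := Rmult_le_compat_l _ _ _ B4 h3; lra.
apply: Rmult_le_pos; first lra.
have : 0 <= t / (sigma / 2) by apply: Rdiv_le_0_compat => //; lra.
lra.
Qed.

End DirichletTail.

Lemma ln_gap (n l : nat) : (1 <= n)%N -> (1 <= l)%N -> n != l ->
  / INR l.+1 <= Rabs (ln (INR l) - ln (INR n)).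
Proof.
move=> n1 l1 nl; have mono i k : (1 <= i)%N -> (i <= k)%N -> ln (INR i) <= ln (INR k).
  by move=> i1 ik; apply: ln_le; [apply: INR_pos | apply: le_INR; lia].
case: (ltngtP n l) => h; last by rewrite h eqxx in nl.
  case: l h l1 nl => // l h _ _; have l1 : (1 <= l)%N by lia.
  apply: Rle_trans (Rle_abs _); have := ln_S_sub l1; have := mono n l n1 h.
  have : / INR l.+2 <= / INR l.+1.
    by apply: Rinv_le_contravar; [apply: INR_pos | apply: le_INR; lia].
  lra.
rewrite Rabs_minus_sym; apply: Rle_trans (Rle_abs _).
by have := ln_S_sub l1; have := mono l.+1 n isT h; lra.
Qed.

Lemma ln_le_INR (n : nat) : (1 <= n)%N -> ln (INR n) <= INR n.
Proof.
move=> n1; have := exp_ineq1_le (ln (INR n)); rewrite exp_ln; first lra.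
exact: INR_pos.
Qed.

Lemma rpow_expn (n p : nat) x : (1 <= n)%N ->
  rpow (n ^ p) x = rpow n (INR p * x).
Proof.
move=> n1; rewrite /rpow INR_expn ln_pow; last exact: INR_pos.
by congr exp; ring.
Qed.

Section CoefficientExtraction.
Variables (a : nat -> C) (F : C -> C).
Hypothesis aF : forall s, 0 < Re s ->
  Clim (fun N => \csum_(1 <= n < N.+1) a n * npow n s)%C (F s).
Variables (sigma : R) (p : nat).
Hypotheses (s0 : 0 < sigma) (ps : 8 <= INR p * sigma).

Let a' (m : nat) : C := (a m * RtoC (rpow m sigma))%C.

(** The m-th term of [F] has frequency log l - log(m j), which is zero only if m j = l and otherwise
    at least 1 / (l + 1) in size, uniformly in m. *)
Lemma avg_character j l N : (1 <= j)%N -> (1 <= l <= N)%N ->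
  Clim (fun y => avg p y
     (fun t => F (sigma, t) * expi ((ln (INR l) - ln (INR j)) * t))%C)
    (\csum_(1 <= m < N.+1 | (m * j == l)%N) a' m).
Proof.
move=> j1 /andP[l1 lN].
have p1 : (1 <= p)%N by case: p ps => //; rewrite /=; lra.
have [D [D0 HD]] := dirichlet_tail aF s0.
have [B HB] := Clim_bounded_terms (aF (s0 : 0 < Re (RtoC sigma))).
have {}HB m : (1 <= m)%N -> Cmod (a' m) <= B.
  by move=> m1; have := HB m m1; rewrite npow_real.
have B0 : 0 <= B := Rle_trans _ _ _ (Cmod_ge_0 _) (HB 1%N isT).
pose q := INR l.+1; have q0 : 0 < q by apply: INR_pos.
have pp := pos_INR p.
pose mu := ln (INR l) - ln (INR j).
(* The first summand is the cost of replacing [F] by its partial sum of length Y^p, the second that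
   of its Y^p damped characters. From N + j on, Y exceeds l + j. *)
apply: (@Clim_rate _ _ (D * (INR p + 2) + B * (4 * q) ^ p.+1) (N + j)) => y hy.
pose Y := y.+1; pose X := (Y ^ p)%N; rewrite -/Y.
have Y0 : 0 < INR Y by apply: INR_pos.
have Y1 : 1 <= INR Y by apply: INR_ge1.
have YX : (Y <= X)%N by rewrite /X -{1}(expn1 Y); apply: leq_pexp2l.
have X1 : (1 <= X)%N by apply: leq_trans YX.
have X0 : 0 < INR X by apply: INR_pos.
have XX1 : (1 <= X * X)%N by nia.
have L1 : (1 <= Y * (X * X))%N by nia.
have XX0 : 0 < INR (X * X) by apply: INR_pos.
have d0 : 0 < / INR (X * X) by apply: Rinv_0_lt_compat.
have Ld : INR (Y * (X * X)) * / INR (X * X) = INR Y.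
  by rewrite mult_INR; field; lra.
rewrite /avg -/Y -/X.
set E := fun h => mean p.+1 (Y * (X * X)) (/ INR (X * X)) h 0.
pose f t := (F (sigma, t) * expi (mu * t))%C.
pose g t := (\csum_(1 <= m < X.+1) a' m * expi ((mu - ln (INR m)) * t))%C.
have fg t : 0 <= t <= INR p.+1 * INR Y ->
    Cmod (f t + - g t) <= D * (INR p + 2) / INR Y.
  move=> [t0 tY]; have -> : (f t + - g t = expi (mu * t) * (F (sigma, t) -
      \csum_(1 <= n < X.+1) a n * npow n (sigma, t)))%C.
    suff -> : g t = (expi (mu * t) *
        \csum_(1 <= n < X.+1) a n * npow n (sigma, t))%C by rewrite /f; ring.
    rewrite /g csum_mulr; apply: eq_bigr => m _.
    rewrite npow_split npow_imag -/(expi _) /a' /=.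
    have -> : (mu - ln (INR m)) * t = mu * t + - t * ln (INR m) by ring.
    by rewrite expi_plus; ring.
  rewrite Cmod_mult Cmod_expi Rmult_1_l.
  apply: Rle_trans (HD X t X1 t0) _.
  have r0 := rpow_pos X (sigma / 4).
  (* Origin of the 8 in [ps]: the tail must gain Y^(-2), because its growth in t costs a factor Y
     over the averaging window. *)
  have r1 : rpow X (sigma / 4) <= (/ INR Y) ^ 2.
    rewrite -(rpow_INR 2 (isT : (1 <= Y)%N)) /X rpow_expn // /rpow.
    apply: exp_le_compat; have lY := ln_ge0 (isT : (1 <= Y)%N).
    have -> : INR 2 = 2 by [].
    have : 2 <= INR p * (sigma / 4) by lra.
    by nra.
  have h1 : 1 + t <= (INR p + 2) * INR Y by rewrite S_INR in tY; nra.
  have h2 : 0 <= D * ((INR p + 2) * INR Y).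
    by apply: Rmult_le_pos => //; apply: Rmult_le_pos; lra.
  apply: Rle_trans (_ : D * ((INR p + 2) * INR Y) * (/ INR Y) ^ 2 <= _).
    apply: Rmult_le_compat => //; [|lra|].
      by apply: Rmult_le_pos; lra.
    by apply: Rmult_le_compat_l.
  by right; field; lra.
have e1 : E f = (E g + E (fun t => f t + - g t))%C.
  rewrite /E -mean_plus; apply: mean_ext => t; ring.
have e2 : Cmod (E (fun t => f t + - g t)%C) <= D * (INR p + 2) / INR Y.
  apply: mean_bound => // u; rewrite Rplus_0_l Ld; exact: fg.
have e3 : (\csum_(1 <= m < N.+1 | (m * j == l)%N) a' m =
    \csum_(1 <= m < X.+1) (if (m * j == l)%N then a' m else 0))%C.
  rewrite big_mkcond [RHS](@csum_shrink N) //; first by lia.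
  by move=> m Nm; case: eqP => // h; nia.
have char m : (1 <= m <= X)%N -> Cmod (a' m * E (fun t =>
    expi ((mu - ln (INR m)) * t)) + - (if (m * j == l)%N then a' m else 0)) <=
    B * (4 * q / INR Y) ^ p.+1.
  move=> /andP[m1 mX].
  have pos : 0 <= B * (4 * q / INR Y) ^ p.+1.
    apply: Rmult_le_pos => //; apply: pow_le; apply: Rdiv_le_0_compat => //; lra.
  have lE : mu - ln (INR m) = ln (INR l) - ln (INR (m * j)).
    by rewrite /mu ln_mult_nat //; ring.
  case: eqP => [h|/eqP h].
    rewrite lE h /E (@mean_ext _ _ _ _ (fun=> RtoC 1)).
      by rewrite mean_const // Cmult_1_r Cplus_opp_r Cmod_0.
    by move=> t; rewrite Rminus_diag Rmult_0_l expi0.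
  have -> : (a' m * E (fun t => expi ((mu - ln (INR m)) * t)) + - 0 =
    a' m * E (fun t => expi ((mu - ln (INR m)) * t)))%C by ring.
  rewrite Cmod_mult.
  apply: Rmult_le_compat; try exact: Cmod_ge_0; first exact: HB.
  have mj1 : (1 <= m * j)%N by nia.
  have gap := ln_gap mj1 l1 h; rewrite -/q -lE in gap.
  have iq : 0 < / q by apply: Rinv_0_lt_compat.
  set lam := mu - _ in gap *; have lam0 : 0 < Rabs lam by lra.
  apply: Rle_trans (@mean_char_bound _ _ L1 d0 p.+1 lam 0 _ _) _.
  - by move=> e0; rewrite e0 Rabs_R0 in lam0; lra.
  (* No aliasing: every frequency is at most 2 X in size, hence at most X^2, the inverse of the
     step. *)
  - apply/(Rle_div_l _ _ _ XX0); rewrite Rmult_1_l mult_INR.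
    have h1 := ln_le_INR l1; have h2 := ln_le_INR j1; have h3 := ln_le_INR m1.
    have h1' := ln_ge0 l1; have h2' := ln_ge0 j1; have h3' := ln_ge0 m1.
    have h4 := le_INR m X ltac:(lia); have h5 := le_INR (l + j).+1 X ltac:(lia).
    have j1R := INR_ge1 j1; rewrite S_INR plus_INR in h5.
    have : Rabs lam <= INR X + INR X by apply: Rabs_le; rewrite /lam /mu; lra.
    nra.
  rewrite Ld; apply: pow_incr; split.
    by apply: Rdiv_le_0_compat; [lra | apply: Rmult_lt_0_compat].
  have -> : 4 * q / INR Y = 4 / (INR Y * / q) by field; lra.
  apply: Rmult_le_compat_l; first lra.
  apply: Rinv_le_contravar; first by apply: Rmult_lt_0_compat.
  by apply: Rmult_le_compat_l; lra.
have e4 : Cmod (E g - \csum_(1 <= m < N.+1 | (m * j == l)%N) a' m) <=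
    B * (4 * q) ^ p.+1 / INR Y.
  rewrite e3; have -> : (E g = \csum_(1 <= m < X.+1) a' m *
      E (fun t => expi ((mu - ln (INR m)) * t)))%C.
    rewrite /E /g mean_csum; apply: eq_bigr => m _; exact: mean_scal.
  set S1 := (\csum_(_ <= _ < _) (_ * _))%C; set S2 := (\csum_(_ <= _ < _) _)%C.
  have -> : (S1 - S2 = S1 + - 1 * S2)%C by ring.
  rewrite /S1 /S2 csum_mulr -csum_plus.
  apply: Rle_trans (Cmod_csum _ _ _) _.
  apply: Rle_trans (_ : \rsum_(1 <= m < X.+1) (B * (4 * q / INR Y) ^ p.+1) <= _).
    apply: rsum_nat_le => m hm; apply: Rle_trans (char m _); last by lia.
    by right; congr (Cmod (_ + _)); ring.
  rewrite rsum_nat_const subSS subn0.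
  have -> : (4 * q / INR Y) ^ p.+1 = (4 * q) ^ p.+1 * (/ INR X * / INR Y).
    rewrite /Rdiv Rpow_mult_distr pow_inv /X INR_expn -Rinv_mult /=.
    by congr (_ * / _); ring.
  by right; field; lra.
have -> : (E f - \csum_(1 <= m < N.+1 | (m * j == l)%N) a' m =
  (E g - \csum_(1 <= m < N.+1 | (m * j == l)%N) a' m) +
  E (fun t => f t + - g t))%C by rewrite e1; ring.
apply: Rle_trans (Cmod_triangle _ _) _.
have -> : (D * (INR p + 2) + B * (4 * q) ^ p.+1) / INR Y =
  D * (INR p + 2) / INR Y + B * (4 * q) ^ p.+1 / INR Y by field; lra.
lra.
Qed.

(** Expansion into characters; cutting [v] at [N] is what truncates the convolution. *)
Lemma avg_bilinear N (u v : nat -> C) :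
  Clim (fun y => avg p y (fun t => F (sigma, t) *
     (\csum_(1 <= j < N.+1) u j * npow j (0, t)) *
     Cconj (\csum_(1 <= l < N.+1) v l * npow l (0, t)))%C)
    (\csum_(1 <= l < N.+1) Cconj (v l) * conv a' u l).
Proof.
have -> : (\csum_(1 <= l < N.+1) Cconj (v l) * conv a' u l =
    \csum_(1 <= j < N.+1) \csum_(1 <= l < N.+1)
    (u j * Cconj (v l)) * \csum_(1 <= m < N.+1 | (m * j == l)%N) a' m)%C.
  rewrite [RHS]exchange_big /=; apply: eq_big_nat => l /andP[_ lN].
  rewrite (@conv_widen N) // csum_mulr.
  have -> : (\csum_(1 <= j < N.+1) u j * Cconj (v l) *
      (\csum_(1 <= m < N.+1 | (m * j == l)%N) a' m) = \csum_(1 <= j < N.+1)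
      \csum_(1 <= m < N.+1) (if (m * j == l)%N then u j * Cconj (v l) * a' m else 0))%C.
    by apply: eq_bigr => j _; rewrite csum_mulr big_mkcond.
  rewrite [RHS]exchange_big; apply: eq_bigr => m _.
  rewrite csum_mulr big_mkcond; apply: eq_bigr => j _.
  by case: ifP => // _; ring.
have H : Clim (fun y => \csum_(1 <= j < N.+1) \csum_(1 <= l < N.+1)
    (u j * Cconj (v l)) * avg p y (fun t => F (sigma, t) *
      expi ((ln (INR l) - ln (INR j)) * t)))%C
    (\csum_(1 <= j < N.+1) \csum_(1 <= l < N.+1)
    (u j * Cconj (v l)) * \csum_(1 <= m < N.+1 | (m * j == l)%N) a' m)%C.
  rewrite big_nat; apply: Clim_ext (Clim_sum (P := fun j => (1 <= j < N.+1)%N) _ _).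
    by move=> y; rewrite -big_nat.
  move=> j hj; rewrite big_nat.
  apply: Clim_ext (Clim_sum (P := fun l => (1 <= l < N.+1)%N) _ _).
    by move=> y; rewrite -big_nat.
  by move=> l hl; apply: Clim_scal; apply: avg_character; lia.
apply: Clim_ext H => y; rewrite /avg; set L := (_ * _)%N; set d := / INR _.
transitivity (mean p.+1 L d (fun t => \csum_(1 <= j < N.+1)
    \csum_(1 <= l < N.+1) (u j * Cconj (v l)) * (F (sigma, t) *
      expi ((ln (INR l) - ln (INR j)) * t)))%C 0).
  rewrite mean_csum; apply: eq_bigr => j _; rewrite mean_csum.
  by apply: eq_bigr => l _; rewrite mean_scal.
apply: mean_ext => t; rewrite Cconj_csum -Cmult_assoc csum_mull csum_mulr.
apply: eq_bigr => j _; rewrite !csum_mulr; apply: eq_bigr => l _.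
rewrite Cmult_conj !npow_imag.
have -> : Cconj (Cexp (0, - t * ln (INR l))) = expi (t * ln (INR l)).
  rewrite /Cconj /expi /Cexp /= -Ropp_mult_distr_l cos_neg sin_neg.
  by rewrite /Cmult /=; congr pair; ring.
rewrite -/(expi _).
have -> : (ln (INR l) - ln (INR j)) * t = t * ln (INR l) + - t * ln (INR j) by ring.
by rewrite expi_plus; ring.
Qed.

End CoefficientExtraction.

(** * Bounded Dirichlet series are multipliers *)

Lemma convC a b n : conv a b n = conv b a n.
Proof.
have e x y : conv x y n = (\csum_(1 <= i < n.+1) \csum_(1 <= j < n.+1)
    (if (i * j == n)%N then x i * y j else 0))%C.
  by apply: eq_bigr => i _; rewrite big_mkcond.
rewrite !e exchange_big; apply: eq_bigr => j _; apply: eq_bigr => i _.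
by rewrite mulnC; case: ifP => // _; ring.
Qed.

Lemma conv_unitl a n : (1 <= n)%N -> conv unit_coef a n = a n.
Proof. by move=> n1; rewrite convC conv_unit. Qed.

Lemma Clim_unit s : Clim (fun N => \csum_(1 <= n < N.+1) unit_coef n * npow n s)%C 1.
Proof.
move=> e e0; exists 1%N => -[//|N] _.
rewrite big_ltn // big_nat big1 => [|n hn]; last first.
  by rewrite /unit_coef; case: eqP => [|_]; [lia | rewrite Cmult_0_l].
rewrite /unit_coef /= npow1n; have -> : (1 * 1 + 0 - 1 = 0)%C by ring.
by rewrite Cmod_0.
Qed.

Lemma RtoC_nsq N b : (\csum_(1 <= l < N.+1) Cconj (b l) * b l)%C = RtoC (nsq N b).
Proof.
rewrite /nsq RtoC_rsum; apply: eq_bigr => l _.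
by rewrite Cmod2_conj Cmult_comm.
Qed.

(** [D] below has as coefficients the convolution [c] up to [N]. From |F| <= M, the quantity M^2
    |G|^2 - 2 Re(F G conj(D)) + |D|^2 is at least |F G - D|^2; in the mean its last two terms add up
    to - [nsq N c]. *)
Lemma bounded_mult_line a F M sigma b N : 0 < sigma ->
  (forall s, 0 < Re s ->
    Clim (fun N => \csum_(1 <= n < N.+1) a n * npow n s)%C (F s)) ->
  (forall s, 0 < Re s -> Cmod (F s) <= M) ->
  nsq N (conv (fun m => a m * RtoC (rpow m sigma))%C b) <= M ^ 2 * nsq N b.
Proof.
move=> s0 aF FM; set c := conv _ b.
have [p hp] := nfloor_ex (8 / sigma) ltac:(by apply: Rdiv_le_0_compat; lra).
have ps : 8 <= INR p.+1 * sigma.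
  by apply/(Rle_div_l _ _ _ s0); rewrite S_INR; lra.
pose G t := (\csum_(1 <= j < N.+1) b j * npow j (0, t))%C.
pose D t := (\csum_(1 <= j < N.+1) c j * npow j (0, t))%C.
(* Parseval for Dirichlet polynomials, read off from [avg_bilinear] with F = 1. *)
have unitP (v : nat -> C) : Clim (fun y => avg p.+1 y (fun t => 1 *
    (\csum_(1 <= j < N.+1) v j * npow j (0, t)) *
    Cconj (\csum_(1 <= l < N.+1) v l * npow l (0, t)))%C) (RtoC (nsq N v)).
  have := avg_bilinear (fun s _ => Clim_unit s) s0 ps N v v.
  rewrite -RtoC_nsq; congr (Clim _ _); apply: eq_big_nat => l /andP[l1 _].
  congr (_ * _)%C; rewrite -[RHS](conv_unitl v l1) convC [RHS]convC.
  apply: conv_ext => m hm; rewrite /unit_coef.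
  by case: eqP => [->|_]; rewrite ?rpow1n ?Cmult_1_r ?Cmult_0_l.
have HG := Clim_scal (RtoC (M ^ 2)) (unitP b).
have HD := unitP c.
have HF := Clim_scal (- 2) (avg_bilinear aF s0 ps N b c).
rewrite RtoC_nsq in HF.
have H := Clim_plus HG (Clim_plus HF HD).
have : 0 <= Re (RtoC (M ^ 2) * RtoC (nsq N b) +
    (- 2 * RtoC (nsq N c) + RtoC (nsq N c))).
  apply: (Re_Clim_ge0 H) => y; rewrite /avg -!mean_scal -!mean_plus.
  set L := (_ * _)%N; set d := / INR _.
  apply: mean_Re_ge0 => [|t]; first by rewrite /L; lia.
  rewrite -/(G t) -/(D t); set z := F _; set g := G t; set w := D t.
  have hz : Cmod z ^ 2 <= M ^ 2.
    apply: pow_incr; split; first exact: Cmod_ge_0.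
    by apply: FM.
  have h1 : Cmod (z * g) ^ 2 <= M ^ 2 * Cmod g ^ 2.
    rewrite Cmod_mult Rpow_mult_distr; apply: Rmult_le_compat_r => //.
    exact: pow2_ge_0.
  rewrite !Cmod_sq in h1.
  have := pow2_ge_0 (Re (z * g) - Re w); have := pow2_ge_0 (Im (z * g) - Im w).
  move: h1; rewrite /Re /Im /=; lra.
by rewrite /Re /=; lra.
Qed.

(** Weighting [a] and [b] by n^(-sigma) weights their convolution likewise, which costs at most
    N^(-2 sigma) >= 1 - 2 sigma log N. For fixed N this tends to 1 with sigma. *)
Lemma bounded_mult_bound a F M b N :
  (forall s, 0 < Re s ->
    Clim (fun N => \csum_(1 <= n < N.+1) a n * npow n s)%C (F s)) ->
  (forall s, 0 < Re s -> Cmod (F s) <= M) ->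
  nsq N (conv a b) <= M ^ 2 * nsq N b.
Proof.
move=> aF FM; case: (posnP N) => [->|N1].
  by rewrite /nsq !big_geq //; lra.
set X := nsq N (conv a b); set Z := M ^ 2 * nsq N b.
have X0 : 0 <= X := nsq_ge0 _ _.
have lN := ln_ge0 N1.
have main sigma : 0 < sigma -> X * (1 - 2 * sigma * ln (INR N)) <= Z.
  move=> s0; pose b' n := (b n * RtoC (rpow n sigma))%C.
  apply: Rle_trans (_ : rpow N sigma ^ 2 * X <= _).
    have -> : rpow N sigma ^ 2 = rpow N (2 * sigma).
      have -> : 2 * sigma = sigma + sigma by ring.
      by rewrite rpow_plus /=; ring.
    rewrite Rmult_comm; apply: Rmult_le_compat_r => //.
    by rewrite /rpow; have := exp_ineq1_le (- (2 * sigma) * ln (INR N)); lra.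
  apply: Rle_trans (_ : M ^ 2 * nsq N b' <= _); last first.
    apply: Rmult_le_compat_l; first exact: pow2_ge_0.
    apply: rsum_nat_le => n /andP[n1 _]; rewrite /b' Cmod_mult Cmod_R.
    have r0 := rpow_pos n sigma; have r1 := rpow_le1 n1 (Rlt_le _ _ s0).
    rewrite Rabs_pos_eq; last lra.
    apply: pow_incr; have := Cmod_ge_0 (b n); split; nra.
  apply: Rle_trans (bounded_mult_line b' N s0 aF FM).
  rewrite /X /nsq rsum_mulr; apply: rsum_nat_le => n /andP[n1 nN].
  have -> : conv (fun m => a m * RtoC (rpow m sigma))%C b' n =
      (conv a b n * RtoC (rpow n sigma))%C.
    rewrite -(npow_real n sigma) -conv_npow /conv.
    by apply: eq_bigr => i _; apply: eq_bigr => j _; rewrite !npow_real.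
  rewrite Cmod_mult Cmod_R -Rpow_mult_distr; apply: pow_incr.
  have r0 := rpow_pos n sigma; have r0' := rpow_pos N sigma.
  rewrite Rabs_pos_eq; last lra.
  have r1 : rpow N sigma <= rpow n sigma by apply: rpow_decr => //; lra.
  have := Cmod_ge_0 (conv a b n); split; nra.
apply: le_epsilon => e e0.
pose K := 2 * ln (INR N) * X + 1.
have K0 : 0 < K by rewrite /K; have := Rmult_le_pos _ _ lN X0; lra.
have := main (e / K) (Rdiv_lt_0_compat _ _ e0 K0).
have : e / K * (K - 1) <= e.
  have -> : e / K * (K - 1) = e - e / K by field; lra.
  by have := Rdiv_lt_0_compat _ _ e0 K0; lra.
rewrite {2}/K; lra.
Qed.

Lemma Hinf_norm_bound F : Rbar_lt (Hinf_norm F) p_infty ->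
  exists M : R, Hinf_norm F = M /\ forall s, 0 < Re s -> Cmod (F s) <= M.
Proof.
rewrite /Hinf_norm; set E := fun r : R => _ => h.
have [ub _] := Lub_Rbar_correct E.
have hs s : 0 < Re s -> Rbar_le (Cmod (F s)) (Lub_Rbar E).
  by move=> s0; apply: ub; exists s.
move: h hs; case: (Lub_Rbar E) => [M| |] h hs.
- by exists M.
- by [].
- by have := hs 1 Rlt_0_1.
Qed.

Lemma square_summable_ext a b : (forall n, (1 <= n)%N -> a n = b n) ->
  square_summable a -> square_summable b.
Proof.
by move=> h; apply: ex_series_ext => n; rewrite h.
Qed.

Lemma is_dirichlet_series_extends a F f :
  is_dirichlet_series 0 a F -> extends F f -> is_dirichlet_series (1 / 2) a f.
Proof.
move=> aF Ff s hs; rewrite -Ff //; apply: aF.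
by move: hs; rewrite /half_plane; lra.
Qed.

Lemma H2_unit A : unital_subsemigroup A -> H2 A (fun=> RtoC 1).
Proof.
move=> uA; exists unit_coef; split; first exact: supported_unit.
split; first by apply/square_summableP; exists 1; apply: nsq_unit.
by apply/is_dirichlet_seriesE => s _; apply: Clim_unit.
Qed.

Lemma multiplier_of_mult_bound A a f M : unital_subsemigroup A ->
  supported_in A a -> is_dirichlet_series (1 / 2) a f ->
  (forall b N, nsq N (conv a b) <= M ^ 2 * nsq N b) ->
  square_summable a /\ multiplier A f.
Proof.
move=> uA sa af hM.
have a2 : square_summable a.
  apply/square_summableP; exists (M ^ 2) => N.
  rewrite (@nsq_ext N a (conv a unit_coef)); last first.
    by move=> n /andP[n1 _]; rewrite conv_unit.
  apply: Rle_trans (hM _ N) _; have := nsq_unit N; have := pow2_ge_0 M; nra.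
split=> // g [b [sb [b2 bg]]]; exists (conv a b).
split; first exact: supported_conv.
split; last exact: dirichlet_mult.
have /square_summableP[B HB] := b2; apply/square_summableP; exists (M ^ 2 * B) => N.
by apply: Rle_trans (hM b N) _; apply: Rmult_le_compat_l => //; apply: pow2_ge_0.
Qed.

(** As 1 is in [A], f = f * 1 lies in H^2 and has coefficients; their uniqueness turns the
    multiplier property into a statement about [conv a]. *)
Lemma multiplier_coef A f : unital_subsemigroup A -> multiplier A f ->
  exists a Q, supported_in A a /\ is_dirichlet_series (1 / 2) a f /\
    0 < Q /\ mult_bound A a Q.
Proof.
move=> uA mf; have [a [sa [a2 af]]] := mf _ (H2_unit uA).
have {}af : is_dirichlet_series (1 / 2) a f.
  by move=> s hs; have := af s hs; rewrite /pointwise_mul Cmult_1_r.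
have [b sb b2|Q [Q0 hQ]] := @mult_bound_ex A a; last by exists a, Q.
have [g bg] := square_summable_dirichlet b2.
have [|c [_ [c2 cfg]]] := mf g; first by exists b.
have hc := dirichlet_coef_unique cfg (dirichlet_mult a2 b2 af bg).
exact: square_summable_ext hc c2.
Qed.

Lemma half_plane_half s : half_plane (1 / 2) s -> 0 < Re s.
Proof. rewrite /half_plane; lra. Qed.

Lemma multiplier_norm_le A a f (M : R) : 0 <= M ->
  is_dirichlet_series (1 / 2) a f -> square_summable a ->
  (forall b N, nsq N (conv a b) <= M ^ 2 * nsq N b) ->
  Rbar_le (multiplier_norm A f) M.
Proof.
move=> M0 af a2 hM; rewrite /multiplier_norm; set E := fun r : R => _.
have [_ lub] := Lub_Rbar_correct E; apply: lub => r.
move=> [g [q [_ [[b [b2 [bg qb]]] [q1 [c [c2 [cfg rc]]]]]]]].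
have hc := dirichlet_coef_unique cfg (dirichlet_mult a2 b2 af bg).
rewrite /= rc -(sqrt_pow2 M M0); apply: l2_norm_le => N.
rewrite (@nsq_ext N c (conv a b)); last by move=> n /andP[n1 _]; apply: hc.
apply: Rle_trans (hM b N) _; have h1 := nsq_le_l2_norm N b2.
have l0 : 0 <= l2_norm b := sqrt_pos _.
have : nsq N b <= 1 by rewrite -qb in l0 h1; rewrite /= in h1; nra.
have := pow2_ge_0 M; nra.
Qed.

Lemma multiplier_norm_mult_bound A a f (w : R) :
  is_dirichlet_series (1 / 2) a f -> square_summable a -> multiplier A f ->
  Rbar_le (multiplier_norm A f) w -> mult_bound A a w.
Proof.
move=> af a2 mf hw b sb N.
have {}hw g q r : H2 A g -> is_H2_norm g q -> q <= 1 ->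
    is_H2_norm (pointwise_mul f g) r -> r <= w.
  move=> h1 h2 h3 h4; move: hw; rewrite /multiplier_norm; set E := fun r : R => _.
  have [ub _] := Lub_Rbar_correct E => h5.
  have : Rbar_le r w by apply: Rbar_le_trans h5; apply: ub; exists g, q.
  by [].
(* The test vector is [b] cut at [N] and normalised; adding [e] avoids a division by zero when [b]
   vanishes up to [N]. *)
suff main e : 0 < e -> nsq N (conv a b) <= w ^ 2 * (nsq N b + e).
  apply: le_epsilon => e e0; have w2 := pow2_ge_0 w.
  have e1 : 0 < e / (w ^ 2 + 1) by apply: Rdiv_lt_0_compat; lra.
  apply: Rle_trans (main _ e1) _; rewrite Rmult_plus_distr_l.
  have -> : w ^ 2 * (e / (w ^ 2 + 1)) = e - e / (w ^ 2 + 1) by field; lra.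
  lra.
move=> e0; have b0 := nsq_ge0 N b.
have x0 : 0 < / sqrt (nsq N b + e).
  by apply: Rinv_0_lt_compat; apply: sqrt_lt_R0; lra.
set x := / sqrt _ in x0.
have x2 : Cmod (RtoC x) ^ 2 * (nsq N b + e) = 1.
  rewrite Cmod_R pow2_abs /x pow_inv pow2_sqrt; last lra.
  by field; lra.
pose b' n := (RtoC x * (if (n <= N)%N then b n else 0))%C.
have sb' : supported_in A b'.
  by move=> n n1 nA; rewrite /b' sb //; case: ifP => _; rewrite Cmult_0_r.
have nb' K : nsq K b' <= 1.
  rewrite nsq_scal; apply: Rle_trans (_ : Cmod (RtoC x) ^ 2 * nsq N b <= _).
    apply: Rmult_le_compat_l; first exact: pow2_ge_0.
    apply: Rle_trans (nsq_widen _ (leq_maxl K N)) _.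
    rewrite (@nsq_stable N) ?leq_maxr //.
      by right; apply: nsq_ext => n /andP[_ ->].
    by move=> n; rewrite ltnNge => /negbTE ->.
  by have := pow2_ge_0 (Cmod (RtoC x)); nra.
have b2' : square_summable b' by apply/square_summableP; exists 1.
have [g bg] := square_summable_dirichlet b2'.
have Hg : H2 A g by exists b'.
have [c [_ [c2 cfg]]] := mf g Hg.
have hc := dirichlet_coef_unique cfg (dirichlet_mult a2 b2' af bg).
have cw : l2_norm c <= w.
  apply: (hw g (l2_norm b')) => //; first by exists b'.
    by rewrite -sqrt_1; apply: l2_norm_le.
  by exists c.
have h1 := nsq_le_l2_norm N c2.
have l0 : 0 <= l2_norm c := sqrt_pos _.
have {cw} h2 : l2_norm c ^ 2 <= w ^ 2 by apply: pow_incr.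
rewrite (@nsq_ext N c (fun n => RtoC x * conv a b n)%C) in h1; last first.
  move=> n /andP[n1 nN]; rewrite hc // -conv_scal.
  by apply: conv_ext => m hm; rewrite /b'; have -> : (m <= N)%N by lia.
rewrite nsq_scal in h1.
have h3 := Rmult_le_compat_r (nsq N b + e) _ _ ltac:(lra) (Rle_trans _ _ _ h1 h2).
apply: Rle_trans h3; right.
by rewrite Rmult_assoc (Rmult_comm (nsq N _)) -Rmult_assoc x2 Rmult_1_l.
Qed.

Theorem proposition3p1 (A : nat -> Prop) (hA : unital_subsemigroup A)
  (f : C -> C) :
  (multiplier A f <-> exists F : C -> C, Hinf A F /\ extends F f) /\
  (forall F : C -> C, Hinf A F -> extends F f ->
     Hinf_norm F = multiplier_norm A f).
Proof.
have dir F : Hinf A F -> extends F f -> exists a (M : R), supported_in A a /\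
    is_dirichlet_series 0 a F /\ is_dirichlet_series (1 / 2) a f /\
    Hinf_norm F = M /\ 0 <= M /\ square_summable a /\ multiplier A f /\
    forall b N, nsq N (conv a b) <= M ^ 2 * nsq N b.
  move=> [[a [sa aF]] /Hinf_norm_bound[M [nM hM]]] Ff.
  have af := is_dirichlet_series_extends aF Ff.
  have hb b N : nsq N (conv a b) <= M ^ 2 * nsq N b.
    apply: (@bounded_mult_bound a F) => // s s0.
    by move/is_dirichlet_seriesE: aF; apply.
  have [a2 mf] := multiplier_of_mult_bound hA sa af hb.
  exists a, M; split=> //; do 3 split=> //; split=> //.
  by apply: Rle_trans (Cmod_ge_0 (F 1)) (hM 1 Rlt_0_1).
split.
  split=> [mf|[F [HF Ff]]]; last first.
    by have [a [M [_ [_ [_ [_ [_ [_ []]]]]]]]] := dir F HF Ff.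
  have [a [Q [sa [af [Q0 hQ]]]]] := multiplier_coef hA mf.
  have conv0 s : 0 < Re s -> exists l,
      Clim (fun N => \csum_(1 <= n < N.+1) a n * npow n s)%C l /\ Cmod l <= Q.
    exact: (mult_bound_convergence hA).
  pose F s := Csum (fun n => a n * npow n s)%C.
  have aF s : 0 < Re s ->
      Clim (fun N => \csum_(1 <= n < N.+1) a n * npow n s)%C (F s).
    by move=> s0; apply: CsumP; have [l [hl _]] := conv0 s s0; exists l.
  exists F; split; last first.
    move=> s hs; apply: Clim_unique (aF s (half_plane_half hs)) _.
    by move/is_dirichlet_seriesE: af; apply.
  split; first by exists a; split=> //; apply/is_dirichlet_seriesE.
  rewrite /Hinf_norm; set E := fun r : R => _.
  have [_ lub] := Lub_Rbar_correct E.
  apply: (Rbar_le_lt_trans _ Q) => //; apply: lub => r [s [s0 ->]].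
  have [l [hl lQ]] := conv0 s s0.
  by rewrite /= (Clim_unique (aF s s0) hl).
move=> F HF Ff.
have [a [M [sa [aF [af [nM [M0 [a2 [mf hb]]]]]]]]] := dir F HF Ff.
have wM := multiplier_norm_le A M0 af a2 hb.
apply: Rbar_le_antisym; last by rewrite nM.
(* Taking g = 0 shows that the supremum is over a non-empty set, so with [wM] it is a real
   number. *)
have w0 : Rbar_le 0 (multiplier_norm A f).
  rewrite /multiplier_norm; set E := fun r : R => _.
  have [ub _] := Lub_Rbar_correct E; apply: ub.
  have z2 : square_summable (fun=> RtoC 0).
    apply/square_summableP; exists 0 => N; rewrite /nsq big1 => [|n _]; first lra.
    by rewrite Cmod_0 /=; ring.
  have zD (g : C -> C) : (forall s, half_plane (1 / 2) s -> g s = 0) ->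
      is_dirichlet_series (1 / 2) (fun=> RtoC 0) g.
    move=> g0; apply/is_dirichlet_seriesE => s hs; rewrite g0 //.
    apply: Clim_ext (Clim_const 0) => N.
    by rewrite big1 // => n _; rewrite Cmult_0_l.
  have zn : l2_norm (fun=> RtoC 0) = 0.
    apply: Rle_antisym; last exact: sqrt_pos.
    apply: Rle_trans (@l2_norm_le _ 0 _) _ => [N|]; last by rewrite sqrt_0; lra.
    rewrite /nsq big1 => [|n _]; first lra.
    by rewrite Cmod_0 /=; ring.
  exists (fun=> RtoC 0), 0; split.
    by exists (fun=> RtoC 0); split=> //; split=> //; apply: zD.
  split.
    by exists (fun=> RtoC 0); split=> //; split; [exact: zD | exact: esym zn].
  split; first lra.
  exists (fun=> RtoC 0); split=> //; split; last exact: esym zn.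
  apply: zD => s _.
  by rewrite /pointwise_mul Cmult_0_r.
have [w ew] : exists w : R, multiplier_norm A f = w.
  by move: w0 wM; case: (multiplier_norm A f) => // w; exists w.
have hw := @multiplier_norm_mult_bound A a f w af a2 mf
  ltac:(by rewrite ew; apply: Rbar_le_refl).
rewrite ew /= in w0; rewrite ew /Hinf_norm; set E := fun r : R => _.
have [_ lub] := Lub_Rbar_correct E; apply: lub => r [s [s0 ->]] /=.
(* The convergence lemma needs a positive bound, but [w] is 0 when f vanishes. *)
apply: le_epsilon => e e0; have we : 0 < w + e by lra.
have hwe : mult_bound A a (w + e).
  move=> b sb N; apply: Rle_trans (hw b sb N) _.
  by apply: Rmult_le_compat_r (nsq_ge0 N b) _; apply: pow_incr; lra.
have [l [hl lw]] := mult_bound_convergence hA sa we hwe s0.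
have aFs : Clim (fun N => \csum_(1 <= n < N.+1) a n * npow n s)%C (F s).
  by move/is_dirichlet_seriesE: aF; apply.
by rewrite (Clim_unique aFs hl).
Qed.
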